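(* Let $\varphi(z)=\frac{az+b}{cz+d}$ be a linear fractional self-map of $\mathbb{D}$ with $\|\varphi\|_\infty=\sup_{z\in\mathbb{D}}|\varphi(z)|<1$, and let $\sigma(z)=\frac{\overline{a}z-\overline{c}}{-\overline{b}z+\overline{d}}$ be its Krein adjoint. Consider $D_\varphi$ acting on $\widetilde{S}^2$. Then there is a finite rank operator $K_1$ on $\widetilde{S}^2$ such that $$D_\varphi^*\,T_z^*=T_z\,D_\sigma+K_1,$$ where adjoints are taken with respect to the inner product of $\widetilde{S}^2$ and $T_z$ denotes multiplication by the function $z$.
   Context: $\mathbb{D}$ is the open unit disk. $\widetilde{S}^2$ is the Hilbert space of analytic $f(z)=\sum_{n\ge0}a_nz^n$ on $\mathbb{D}$ with inner product $\langle f,g\rangle=a_0\overline{b_0}+a_1\overline{b_1}+\sum_{n\ge2}n(n-1)a_n\overline{b_n}$ for $g(z)=\sum b_nz^n$ (a weighted Hardy space with weights $\beta(0)=\beta(1)=1$, $\beta(n)=\sqrt{n(n-1)}$ for $n\ge2$; it has the same elements as $S^2$ with an equivalent norm). Its reproducing kernel is $K_w(z)=1+2\overline{w}z+(1-\overline{w}z)\log(1-\overline{w}z)$, and the kernel for evaluation of the derivative at $w$ is $K^{(1)}_w(z)=z-z\log(1-\overline{w}z)$. $D_\varphi f=f'\circ\varphi$; $T_\psi f=\psi f$ denotes multiplication by $\psi$. *)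

(* Defs.v *)
From Stdlib Require Import Reals ClassicalEpsilon.
From Coquelicot Require Import Coquelicot.

Open Scope C_scope.

(* Sum of a convergent complex series (chosen value; meaningful when it converges). *)
Definition csum (u : nat -> C) : C :=
  epsilon (inhabits (RtoC 0%R)) (fun l => @is_series C_AbsRing C_NormedModule u l).

Fixpoint fsum (n : nat) (u : nat -> C) : C :=
  match n with O => RtoC 0%R | S k => fsum k u + u k end.

Definition in_disk (z : C) : Prop := (Cmod z < 1)%R.

(* squared weights beta(n)^2: 1, 1, n(n-1) for n >= 2 *)
Definition weight (n : nat) : R :=
  match n with
  | O => 1%R
  | S O => 1%R
  | _ => (INR n * INR (n - 1))%R
  end.

Definition has_coefs (f : C -> C) (a : nat -> C) : Prop :=
  forall z, in_disk z ->
    @is_series C_AbsRing C_NormedModule (fun n => a n * z ^ n) (f z).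

(* membership in tilde S^2 (functions are identified with their values on D) *)
Definition in_S (f : C -> C) : Prop :=
  exists a, has_coefs f a /\
    ex_series (fun n => (weight n * (Cmod (a n)) ^ 2)%R).

(* the Taylor coefficients of f on D (unique when they exist) *)
Definition coef (f : C -> C) : nat -> C :=
  epsilon (inhabits (fun _ => RtoC 0%R)) (fun a => has_coefs f a).

Definition ip (f g : C -> C) : C :=
  csum (fun n => RtoC (weight n) * coef f n * Cconj (coef g n)).

Definition Snorm (f : C -> C) : R := sqrt (Re (ip f f)).

Definition Tz (f : C -> C) : C -> C := fun z => z * f z.

Definition cderiv (f : C -> C) : C -> C :=
  fun w => csum (fun n => RtoC (INR (S n)) * coef f (S n) * w ^ n).

Definition Dop (phi : C -> C) (f : C -> C) : C -> C := fun z => cderiv f (phi z).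

Definition lft (a b c d : C) (z : C) : C := (a * z + b) / (c * z + d).

Definition krein_adjoint (a b c d : C) (z : C) : C :=
  (Cconj a * z - Cconj c) / (- Cconj b * z + Cconj d).

Definition finite_rank_op (K : (C -> C) -> (C -> C)) : Prop :=
  (forall f, in_S f -> in_S (K f)) /\
  (forall f g, in_S f -> in_S g -> forall z, in_disk z ->
      K (fun w => f w + g w) z = K f z + K g z) /\
  (forall (l : C) f, in_S f -> forall z, in_disk z ->
      K (fun w => l * f w) z = l * K f z) /\
  (exists M : R, forall f, in_S f -> (Snorm (K f) <= M * Snorm f)%R) /\
  (exists (n : nat) (e : nat -> C -> C),
      (forall i, (i < n)%nat -> in_S (e i)) /\
      forall f, in_S f -> exists cs : nat -> C,
        forall z, in_disk z -> K f z = fsum n (fun i => cs i * e i z)).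

(* Main.v *)
(** Both [<z f'(sigma), g>] and [<f, z g'(phi)>] are double series in
    [a_(k+1) conj(b_(n+1))], with [a], [b] the Taylor coefficients of [f], [g], whose
    terms involve the coefficient of [z^n] in [sigma^k] and the conjugate of the coefficient of
    [z^k] in [phi^n] respectively. For [n, k >= 1], [n] times the former equals [k] times the
    latter, so the two double series agree except for [n = 0] or [k = 0], and these terms
    account for the correction of rank two. The identity holds because, writing
    [(sigma^k)' = k sigma^(k-1) sigma'], the coefficients of [sigma^(k-1) sigma'] and those of
    the conjugate of [phi^n] satisfy the same linear recurrence in [(n, k)]. The rearrangement is
    legitimate since [phi] and [sigma] map a disk of radius [T > 1] into the disk of radius
    [1/T], so that the coefficients in question are at most [T^(-n-k)]; this Cauchy estimate is
    obtained from a contraction property in l^2 instead of contour integrals. *)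
Require Import Defs.
From Stdlib Require Import Reals Lra Lia ClassicalEpsilon FunctionalExtensionality.
From Coquelicot Require Import Coquelicot.
Open Scope C_scope.

(** * Complex series *)

Notation cseries := (@is_series C_AbsRing C_NormedModule).

Lemma cseries_ext (u v : nat -> C) (l : C) :
  (forall n, u n = v n) -> cseries u l -> cseries v l.
Proof. apply is_series_ext. Qed.

Lemma cseries_plus (u v : nat -> C) (l m : C) :
  cseries u l -> cseries v m -> cseries (fun n => u n + v n) (l + m).
Proof. apply (is_series_plus (V := C_NormedModule)). Qed.

Lemma cseries_scal (k : C) (u : nat -> C) (l : C) :
  cseries u l -> cseries (fun n => k * u n) (k * l).
Proof. apply (is_series_scal (V := C_NormedModule)). Qed.

Lemma cseries_unique (u : nat -> C) (l m : C) :
  cseries u l -> cseries u m -> l = m.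
Proof.
  intros H1 H2.
  exact (@filterlim_locally_unique nat C_AbsRing C_NormedModule eventually _ _ l m H1 H2).
Qed.

Lemma csum_eq (u : nat -> C) (l : C) : cseries u l -> csum u = l.
Proof.
  intros H; apply cseries_unique with u; [|exact H].
  unfold csum; apply epsilon_spec; exists l; exact H.
Qed.

Lemma cseries_cons (u : nat -> C) (l : C) :
  cseries (fun n => u (S n)) l -> cseries u (u O + l).
Proof.
  intros H; apply (is_series_decr_1 (V := C_NormedModule)).
  assert (E : u O + l + - u O = l) by ring.
  change (cseries (fun n => u (S n)) (u O + l + - u O)); now rewrite E.
Qed.

Lemma cseries_tail (u : nat -> C) (l : C) :
  cseries u l -> cseries (fun n => u (S n)) (l - u O).
Proof.
  intros H; apply (is_series_incr_1 (V := C_NormedModule)).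
  assert (E : l - u O + u O = l) by ring.
  change (cseries u (l - u O + u O)); now rewrite E.
Qed.

Lemma cseries_le (u : nat -> C) (l : C) (b : nat -> R) (B : R) :
  cseries u l -> is_series b B -> (forall n, (Cmod (u n) <= b n)%R) ->
  (Cmod l <= B)%R.
Proof.
  intros Hu Hb Hle.
  assert (H1 : is_lim_seq (fun n => Cmod (sum_n u n)) (Cmod l)).
  { apply (filterlim_comp _ _ _ _ _ _ _ _ Hu).
    exact (@filterlim_norm C_AbsRing C_NormedModule l). }
  apply (is_lim_seq_le (fun n => Cmod (sum_n u n)) (sum_n b) (Cmod l) B); [|exact H1|exact Hb].
  intros n; eapply Rle_trans; [exact (@norm_sum_n_m C_AbsRing C_NormedModule u 0 n)|].
  apply sum_n_m_le; exact Hle.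
Qed.

Lemma cseries_dominated (u : nat -> C) (b : nat -> R) :
  ex_series b -> (forall n, (Cmod (u n) <= b n)%R) -> exists l : C, cseries u l.
Proof.
  intros Hb Hle.
  exact (@ex_series_le C_AbsRing C_CompleteNormedModule u b Hle Hb).
Qed.

Lemma is_series_scaled_geom (M p : R) :
  (0 <= p < 1)%R -> is_series (fun n => (M * p ^ n)%R) (M / (1 - p))%R.
Proof.
  intros Hp; apply (is_series_scal (V := R_NormedModule) M).
  apply is_series_geom; rewrite Rabs_pos_eq; lra.
Qed.

Lemma cseries_geom_dominated (M p : R) (u : nat -> C) :
  (0 <= p < 1)%R -> (forall n, (Cmod (u n) <= M * p ^ n)%R) -> exists l : C, cseries u l.
Proof.
  intros Hp Hu; apply cseries_dominated with (2 := Hu).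
  eexists; apply is_series_scaled_geom, Hp.
Qed.

Lemma cseries_geom_le (M p : R) (u : nat -> C) (l : C) :
  (0 <= p < 1)%R -> (forall n, (Cmod (u n) <= M * p ^ n)%R) -> cseries u l ->
  (Cmod l <= M / (1 - p))%R.
Proof.
  intros Hp Hu Hl; exact (cseries_le _ _ _ _ Hl (is_series_scaled_geom M p Hp) Hu).
Qed.

Lemma cseries_Re (u : nat -> C) (l : C) :
  cseries u l -> is_series (fun n => Re (u n)) (Re l).
Proof.
  intros H.
  assert (E : forall n, sum_n (fun k => Re (u k)) n = Re (sum_n u n)).
  { induction n; [now rewrite !sum_O | rewrite !sum_Sn, IHn; reflexivity]. }
  apply filterlim_ext with (fun n => Re (sum_n u n)); [intros; now rewrite E|].
  apply (filterlim_comp _ _ _ _ _ _ _ _ H).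
  intros P [e He]; exists e; intros y [Hy _]; apply He, Hy.
Qed.

Lemma cseries_Im (u : nat -> C) (l : C) :
  cseries u l -> is_series (fun n => Im (u n)) (Im l).
Proof.
  intros H.
  assert (E : forall n, sum_n (fun k => Im (u k)) n = Im (sum_n u n)).
  { induction n; [now rewrite !sum_O | rewrite !sum_Sn, IHn; reflexivity]. }
  apply filterlim_ext with (fun n => Im (sum_n u n)); [intros; now rewrite E|].
  apply (filterlim_comp _ _ _ _ _ _ _ _ H).
  intros P [e He]; exists e; intros y [_ Hy]; apply He, Hy.
Qed.

Lemma cseries_of_Re_Im (u : nat -> C) (x y : R) :
  is_series (fun n => Re (u n)) x -> is_series (fun n => Im (u n)) y ->
  cseries u (x, y).
Proof.
  intros Hx Hy.
  assert (E : forall n, (sum_n (fun k => Re (u k)) n, sum_n (fun k => Im (u k)) n)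
                        = sum_n u n).
  { induction n; [rewrite !sum_O; now destruct (u O)
                 | rewrite !sum_Sn, <- IHn; reflexivity]. }
  apply filterlim_ext with (1 := E).
  apply (filterlim_locally (U := C_UniformSpace)); intros eps.
  assert (Hx' := proj1 (filterlim_locally _ _) Hx eps).
  assert (Hy' := proj1 (filterlim_locally _ _) Hy eps).
  apply filter_imp with (2 := filter_and _ _ Hx' Hy').
  intros n [H1 H2]; split; assumption.
Qed.

Lemma cseries_conj (u : nat -> C) (l : C) :
  cseries u l -> cseries (fun n => Cconj (u n)) (Cconj l).
Proof.
  intros H; apply cseries_of_Re_Im.
  - exact (cseries_Re _ _ H).
  - apply (is_series_opp (V := R_NormedModule) (fun n => Im (u n))).
    exact (cseries_Im _ _ H).
Qed.

Lemma cseries_RtoC (u : nat -> R) (l : R) :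
  is_series u l -> cseries (fun n => RtoC (u n)) (RtoC l).
Proof.
  intros H; apply cseries_of_Re_Im; [exact H|].
  (* The zero series of imaginary parts is obtained as [0] times the convergent series [u]. *)
  assert (H0 := is_series_scal (V := R_NormedModule) 0%R u l H).
  change (scal 0%R l) with (0 * l)%R in H0; rewrite Rmult_0_l in H0.
  apply is_series_ext with (2 := H0); intros n.
  change (0 * u n = 0)%R; ring.
Qed.

Lemma cseries_single (u : nat -> C) :
  (forall n, u (S n) = RtoC 0%R) -> cseries u (u O).
Proof.
  intros H; replace (u O) with (u O + RtoC 0%R) by ring.
  apply cseries_cons.
  apply cseries_ext with (fun n => RtoC (0 * 0 ^ n)%R).
  - intros n; now rewrite Rmult_0_l, H.
  - apply cseries_RtoC; assert (H0 := is_series_scaled_geom 0 0 ltac:(lra)).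
    now replace (0 / (1 - 0))%R with 0%R in H0 by field.
Qed.

Lemma cseries_sum_n (t : nat -> nat -> C) (r : nat -> C) :
  (forall k, cseries (fun n => t n k) (r k)) ->
  forall K, cseries (fun n => sum_n (t n) K) (sum_n r K).
Proof.
  intros H; induction K.
  - rewrite sum_O; apply cseries_ext with (2 := H O); intros; now rewrite sum_O.
  - rewrite sum_Sn; apply cseries_ext with (fun n => sum_n (t n) K + t n (S K)).
    + intros n; now rewrite sum_Sn.
    + now apply cseries_plus.
Qed.

(** * Remainder estimates and interchange of summations *)

Lemma cseries_remainder (M p : R) (u : nat -> C) (l : C) :
  (0 <= p < 1)%R -> (forall n, (Cmod (u n) <= M * p ^ n)%R) -> cseries u l ->
  forall K, (Cmod (l - sum_n u K) <= M * p ^ S K / (1 - p))%R.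
Proof.
  intros Hp Hu Hl K; revert u l M Hu Hl; induction K; intros u l M Hu Hl.
  - rewrite sum_O; apply cseries_geom_le with (fun n => u (S n)); [assumption| |].
    + intros n; eapply Rle_trans; [apply Hu|]; simpl; lra.
    + now apply cseries_tail.
  (* Without its first term the series is bounded with the same ratio and the constant [M * p]. *)
  - replace (l - sum_n u (S K)) with ((l - u O) - sum_n (fun n => u (S n)) K).
    + replace (M * p ^ S (S K))%R with (M * p * p ^ S K)%R by (simpl; ring).
      apply IHK.
      * intros n; eapply Rle_trans; [apply Hu|]; simpl; lra.
      * now apply cseries_tail.
    + assert (E : sum_n u (S K) = u O + sum_n (fun n => u (S n)) K).
      { clear; induction K; [now rewrite sum_Sn, !sum_O|].
        rewrite sum_Sn, IHK, (sum_Sn (fun n => u (S n))).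
        change (u O + sum_n (fun n => u (S n)) K + u (S (S K)) =
                u O + (sum_n (fun n => u (S n)) K + u (S (S K)))); ring. }
      rewrite E; ring.
Qed.

Lemma cseries_intro (u : nat -> C) (l : C) :
  (forall eps : posreal, eventually (fun n => (Cmod (l - sum_n u n) < eps)%R)) ->
  cseries u l.
Proof.
  intros H; apply (@filterlim_locally_ball_norm C_AbsRing nat C_NormedModule eventually _).
  intros eps; apply filter_imp with (2 := H eps); intros n Hn.
  unfold ball_norm; change (norm (minus (sum_n u n) l)) with (Cmod (sum_n u n - l)).
  rewrite <- Cmod_opp; replace (- (sum_n u n - l)) with (l - sum_n u n) by ring.
  exact Hn.
Qed.

(** The tail [s - sum_n c K] is the sum over [n] of the row remainders [r n - sum_n (t n) K]. Each
    is at most [M p^n p^(K+1) / (1 - p)], so summing over [n] leaves a constant times [p^(K+1)].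
    Convergence of the series [c] is part of the conclusion. *)
Lemma cseries_fubini (M p : R) (t : nat -> nat -> C) (r c : nat -> C) (s : C) :
  (0 <= p < 1)%R ->
  (forall n k, (Cmod (t n k) <= M * p ^ n * p ^ k)%R) ->
  (forall n, cseries (t n) (r n)) ->
  (forall k, cseries (fun n => t n k) (c k)) ->
  cseries r s -> cseries c s.
Proof.
  intros Hp Ht Hr Hc Hs; apply cseries_intro; intros eps.
  assert (HM : (0 <= M)%R).
  { specialize (Ht O O); simpl in Ht; assert (H := Cmod_ge_0 (t O O)); lra. }
  assert (Hb : forall K, (Cmod (s - sum_n c K) <= M / (1 - p) / (1 - p) * p ^ S K)%R).
  { intros K.
    replace (M / (1 - p) / (1 - p) * p ^ S K)%R
      with (M * p ^ S K / (1 - p) / (1 - p))%R by (field; lra).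
    apply cseries_geom_le with (fun n => r n - sum_n (t n) K); [assumption| |].
    - intros n; eapply Rle_trans.
      + apply cseries_remainder with (M := (M * p ^ n)%R) (p := p); auto.
      + apply Req_le; field; lra.
    - apply cseries_ext with (fun n => r n + (- (1)) * sum_n (t n) K).
      + intros n; ring.
      + replace (s - sum_n c K) with (s + (- (1)) * sum_n c K) by ring.
        apply cseries_plus; [assumption|].
        apply cseries_scal, cseries_sum_n, Hc. }
  assert (Hlim : is_lim_seq (fun K => (M / (1 - p) / (1 - p) * p ^ S K)%R) 0%R).
  { replace (Finite 0%R) with (Rbar_mult (M / (1 - p) / (1 - p))%R 0%R)
      by (simpl; f_equal; ring).
    apply is_lim_seq_scal_l.
    apply (is_lim_seq_incr_1 (fun n => (p ^ n)%R)).
    apply is_lim_seq_geom; rewrite Rabs_pos_eq; lra. }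
  apply is_lim_seq_spec in Hlim.
  apply filter_imp with (2 := Hlim eps); intros K HK.
  eapply Rle_lt_trans; [apply Hb|].
  rewrite Rminus_0_r in HK; exact (Rle_lt_trans _ _ _ (Rle_abs _) HK).
Qed.

(** On the real segment the real and imaginary parts of [f] are real power series, whose
    coefficients are determined by the derivatives at 0. *)
Lemma has_coefs_unique (f : C -> C) (a b : nat -> C) :
  has_coefs f a -> has_coefs f b -> forall n, a n = b n.
Proof.
  intros Ha Hb.
  (* [P] stands for [Re] or [Im]; only its compatibility with series and with real factors is
     used. *)
  assert (part : forall (P : C -> R),
    (forall u l, cseries u l -> is_series (fun n => P (u n)) (P l)) ->
    (forall (z : C) (x : R), P (Cmult z (RtoC x)) = P z * x)%R ->
    forall n, P (a n) = P (b n)).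
  { intros P HP HPx.
    assert (key : forall e, has_coefs f e ->
      (forall x, (Rabs x < 1)%R -> PSeries (fun n => P (e n)) x = P (f (RtoC x))) /\
      Rbar_lt 0%R (CV_radius (fun n => P (e n)))).
    { intros e He.
      assert (Hs : forall x, (Rabs x < 1)%R ->
        is_series (fun n => (P (e n) * x ^ n)%R) (P (f (RtoC x)))).
      { intros x Hx.
        apply is_series_ext with (fun n => P (e n * RtoC x ^ n)).
        - intros n; now rewrite <- RtoC_pow, HPx.
        - apply HP, He; unfold in_disk; now rewrite Cmod_R. }
      split.
      - intros x Hx; apply is_series_unique, Hs, Hx.
      - assert (H2 : (Rabs (/2) < 1)%R) by (rewrite Rabs_pos_eq; lra).
        destruct (Rbar_lt_dec 0%R (CV_radius (fun n => P (e n)))) as [|Hn]; [assumption|].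
        (* A radius at most 0 would put [1/2] outside the disk of convergence, yet the terms there
           tend to 0. *)
        exfalso; apply (CV_disk_outside (fun n => P (e n)) (/2)%R).
        + apply Rbar_not_lt_le in Hn.
          apply Rbar_le_lt_trans with (1 := Hn).
          simpl; rewrite Rabs_pos_eq; lra.
        + apply ex_series_lim_0; eexists; exact (Hs _ H2). }
    destruct (key a Ha) as [Ea Ra]; destruct (key b Hb) as [Eb Rb]; intros n.
    apply Rmult_eq_reg_r with (INR (Factorial.fact n)); [|apply INR_fact_neq_0].
    rewrite <- (Derive_n_coef _ n Ra), <- (Derive_n_coef _ n Rb).
    apply Derive_n_ext_loc; exists (mkposreal 1 Rlt_0_1); intros x Hx.
    assert (Hx' : (Rabs x < 1)%R).
    { unfold ball in Hx; simpl in Hx; unfold AbsRing_ball, abs, minus, plus, opp in Hx.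
      simpl in Hx; now rewrite Ropp_0, Rplus_0_r in Hx. }
    now rewrite Ea, Eb. }
  intros n.
  rewrite (surjective_pairing (a n)), (surjective_pairing (b n)); f_equal.
  - apply (part Re); [apply cseries_Re | intros z x; unfold Re, Im; simpl; ring].
  - apply (part Im); [apply cseries_Im | intros z x; unfold Re, Im; simpl; ring].
Qed.

(** * Power series multiplied and divided by linear factors *)

(* Coefficients of [(p z + q) u(z)] and of [u(z) / (p z + q)]. *)
Definition lmul (p q : C) (u : nat -> C) (n : nat) : C :=
  match n with O => q * u O | S m => q * u (S m) + p * u m end.

Fixpoint ldiv (p q : C) (u : nat -> C) (n : nat) : C :=
  match n with O => u O / q | S m => (u (S m) - p * ldiv p q u m) / q end.

Definition lder (u : nat -> C) (n : nat) : C := RtoC (INR (S n)) * u (S n).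

(* [lft_coef a b c d k n] is the coefficient of [z ^ n] in [(lft a b c d z) ^ k]. *)
Fixpoint lft_coef (a b c d : C) (k : nat) : nat -> C :=
  match k with
  | O => fun n => match n with O => RtoC 1%R | S _ => RtoC 0%R end
  | S j => lmul a b (ldiv c d (lft_coef a b c d j))
  end.

Lemma lmul_ldiv (p q : C) (u : nat -> C) :
  q <> RtoC 0%R -> lmul p q (ldiv p q u) = u.
Proof.
  intros Hq; apply functional_extensionality; intros [|n]; simpl; field; exact Hq.
Qed.

Lemma ldiv_lmul (p q : C) (u : nat -> C) :
  q <> RtoC 0%R -> ldiv p q (lmul p q u) = u.
Proof.
  intros Hq; apply functional_extensionality; intros n; induction n as [|n IHn]; simpl.
  - field; exact Hq.
  - rewrite IHn; field; exact Hq.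
Qed.

Lemma lmul_comm (p q r s : C) (u : nat -> C) :
  lmul p q (lmul r s u) = lmul r s (lmul p q u).
Proof. apply functional_extensionality; intros [|[|n]]; simpl; ring. Qed.

Lemma lmul_ldiv_comm (p q r s : C) (u : nat -> C) :
  s <> RtoC 0%R -> lmul p q (ldiv r s u) = ldiv r s (lmul p q u).
Proof.
  intros Hs; rewrite <- (ldiv_lmul r s (lmul p q (ldiv r s u)) Hs).
  now rewrite lmul_comm, lmul_ldiv.
Qed.

(** This is [(c z + d) phi^(k+1) = (a z + b) phi^k], the division-free recurrence used both for the
    duality of coefficients and for summing the series of [phi^k]. *)
Lemma lmul_lft_coef (a b c d : C) (k : nat) :
  d <> RtoC 0%R ->
  lmul c d (lft_coef a b c d (S k)) = lmul a b (lft_coef a b c d k).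
Proof. intros HD; simpl; now rewrite lmul_comm, lmul_ldiv. Qed.

(** The product rule; the last term comes from the derivative [p] of the linear factor. *)
Lemma lder_lmul (p q : C) (u : nat -> C) (n : nat) :
  lder (lmul p q u) n = lmul p q (lder u) n + p * u n.
Proof.
  unfold lder; destruct n; cbn [lmul]; rewrite ?S_INR, ?RtoC_plus; simpl INR; ring.
Qed.

(* The derivative of [phi ^ (k+1)] is [(k+1) phi ^ k (a d - b c) / (c z + d) ^ 2]. *)
Lemma lder_lft_coef (a b c d : C) (k : nat) :
  d <> RtoC 0%R ->
  lder (lft_coef a b c d (S k)) =
  (fun n => RtoC (INR (S k)) * (a * d - b * c)
            * ldiv c d (ldiv c d (lft_coef a b c d k)) n).
Proof.
  intros HD.
  assert (scale : forall l p q u, lmul p q (fun n => l * u n) = (fun n => l * lmul p q u n)).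
  { intros; apply functional_extensionality; intros [|n]; simpl; ring. }
  (* With [h = phi^j / (c z + d)], the product rule is applied to [phi^(j+1) = (a z + b) h] and to
     [phi^j = (c z + d) h]. Eliminating [h'] leaves [h] times
     [a (c z + d) - c (a z + b) = a d - b c]. *)
  assert (step : forall j, lmul c d (lder (lft_coef a b c d (S j))) =
     (fun n => lmul a b (lder (lft_coef a b c d j)) n
               + (a * d - b * c) * ldiv c d (lft_coef a b c d j) n)).
  { intros j; set (h := ldiv c d (lft_coef a b c d j)).
    assert (Hh : lft_coef a b c d j = lmul c d h) by (unfold h; now rewrite lmul_ldiv).
    change (lft_coef a b c d (S j)) with (lmul a b h).
    replace (lder (lmul a b h)) with (fun n => lmul a b (lder h) n + a * h n)
      by (apply functional_extensionality; intros; now rewrite lder_lmul).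
    rewrite Hh.
    replace (lder (lmul c d h)) with (fun n => lmul c d (lder h) n + c * h n)
      by (apply functional_extensionality; intros; now rewrite lder_lmul).
    apply functional_extensionality; intros [|[|n]]; simpl; ring. }
  (* The induction runs on the claim multiplied by [c z + d], the form delivered by [step]. *)
  assert (goal : lmul c d (lder (lft_coef a b c d (S k))) =
     (fun n => RtoC (INR (S k)) * (a * d - b * c) * ldiv c d (lft_coef a b c d k) n)).
  { induction k as [|k IHk]; rewrite step.
    - apply functional_extensionality; intros [|n]; simpl; unfold lder; simpl; ring.
    - assert (E : lder (lft_coef a b c d (S k)) = (fun n => RtoC (INR (S k)) *
          (a * d - b * c) * ldiv c d (ldiv c d (lft_coef a b c d k)) n)).
      { rewrite <- (ldiv_lmul c d (lder _) HD), IHk.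
        rewrite <- (ldiv_lmul c d (fun n => _ * _ * ldiv c d (ldiv c d _) n) HD).
        now rewrite scale, lmul_ldiv. }
      rewrite E, scale, lmul_ldiv_comm by assumption.
      change (lmul a b (ldiv c d (lft_coef a b c d k))) with (lft_coef a b c d (S k)).
      apply functional_extensionality; intros n.
      rewrite (S_INR (S k)), RtoC_plus; ring. }
  rewrite <- (ldiv_lmul c d (lder _) HD), goal.
  rewrite <- (ldiv_lmul c d (fun n => _ * _ * ldiv c d (ldiv c d _) n) HD).
  now rewrite scale, lmul_ldiv.
Qed.

(** * Duality between the coefficients of powers of phi and of sigma *)

Lemma lft_coef_0_r (a b c d : C) (k : nat) :
  lft_coef a b c d k O = (b / d) ^ k.
Proof. induction k as [|k IHk]; simpl; [reflexivity|rewrite IHk; unfold Cdiv; ring]. Qed.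

(* Both sides satisfy the recurrence
   [d X (k+1) (n+1) = b X (k+1) n + a X k n - c X k (n+1)]. *)
Lemma lft_coef_adjoint_deriv (a b c d : C) :
  d <> RtoC 0%R -> forall k n,
  (a * d - b * c) * ldiv (- b) d (ldiv (- b) d (lft_coef a (- c) (- b) d k)) n
  = lft_coef a b c d (S n) (S k).
Proof.
  intros HD.
  (* Without conjugations, [sigma = (a z - c) / (d - b z)]. [R k] lists the coefficients of
     [sigma^k / (d - b z)^2], which times [a d - b c] is [sigma^k sigma']. *)
  set (R := fun k => ldiv (- b) d (ldiv (- b) d (lft_coef a (- c) (- b) d k))).
  set (P := lft_coef a b c d).
  assert (canc : forall x y : C, d * x = d * y -> x = y).
  { intros x y H; replace x with (d * x / d) by (field; exact HD).
    rewrite H; field; exact HD. }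
  assert (HR : forall k, lmul (- b) d (R (S k)) = lmul a (- c) (R k)).
  { intros k; unfold R; rewrite lmul_ldiv by assumption.
    now rewrite lmul_ldiv_comm. }
  assert (HP : forall n, lmul c d (P (S n)) = lmul a b (P n)).
  { intros n; apply lmul_lft_coef, HD. }
  assert (HP0 : forall n, P n O = (b / d) ^ n) by (intros; apply lft_coef_0_r).
  assert (HPS : forall n, P O (S n) = RtoC 0%R) by reflexivity.
  clearbody P.
  enough (H : forall k n, (a * d - b * c) * R k n = P (S n) (S k)) by exact H.
  induction k as [|k IHk].
  (* For [k = 0], [R O] is [g / (d - b z)] with [g] the geometric series of [1 / (d - b z)]; it is
     compared with the coefficient of [z] in [phi^(n+1)] by induction on [n]. *)
  - set (g := ldiv (- b) d (lft_coef a (- c) (- b) d O)).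
    assert (Hg : forall n, d * g n = (b / d) ^ n).
    { induction n as [|n IHn].
      - unfold g; simpl; field; exact HD.
      - assert (E0 : lmul (- b) d g (S n) = RtoC 0%R)
          by (unfold g; now rewrite lmul_ldiv).
        cbn [lmul] in E0.
        transitivity (d * g (S n) + - b * g n + b / d * (d * g n)); [field; exact HD|].
        rewrite E0, IHn; simpl; ring. }
    induction n as [|n IHn]; apply canc.
    + assert (E := f_equal (fun u => u 1%nat) (HP O)); cbn [lmul] in E.
      rewrite HPS, !HP0 in E.
      replace (d * P 1%nat 1%nat) with (a - c * (b / d)).
      * unfold R; simpl; field; exact HD.
      * transitivity (d * P 1%nat 1%nat + c * (b / d) ^ 1 - c * (b / d)).
        -- rewrite E; simpl; ring.
        -- simpl; ring.
    + assert (E := f_equal (fun u => u 1%nat) (HP (S n))); cbn [lmul] in E.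
      rewrite !HP0 in E.
      assert (E' : d * R O (S n) = g (S n) + b * R O n).
      { assert (E0 : lmul (- b) d (R O) (S n) = g (S n))
          by (unfold R; now rewrite lmul_ldiv).
        cbn [lmul] in E0; rewrite <- E0; ring. }
      transitivity ((a * d - b * c) * (d * R O (S n))); [ring|].
      rewrite E'; transitivity (b * ((a * d - b * c) * R O n) + (a * d - b * c) * g (S n)); [ring|].
      rewrite IHn.
      replace ((a * d - b * c) * g (S n)) with ((a - c * (b / d)) * (d * g (S n)))
        by (field; exact HD).
      rewrite Hg.
      transitivity (d * P (S (S n)) 1%nat + c * (b / d) ^ S (S n) - c * (b / d) ^ S (S n)); [|ring].
      rewrite E; simpl; ring.
  (* At [n = 0] the terms of [P O] drop out, since [phi^0 = 1] has no coefficients of positive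
     degree. *)
  - induction n as [|n IHn]; apply canc.
    + assert (E := f_equal (fun u => u (S (S k))) (HP O)); cbn [lmul] in E.
      assert (E' := f_equal (fun u => u O) (HR k)); cbn [lmul] in E'.
      transitivity ((a * d - b * c) * (d * R (S k) O)); [ring|]; rewrite E'.
      transitivity (- c * ((a * d - b * c) * R k O)); [ring|]; rewrite IHk.
      transitivity (d * P 1%nat (S (S k)) + c * P 1%nat (S k) - c * P 1%nat (S k)); [|ring].
      rewrite E, !HPS; ring.
    + assert (E := f_equal (fun u => u (S (S k))) (HP (S n))); cbn [lmul] in E.
      assert (E' := f_equal (fun u => u (S n)) (HR k)); cbn [lmul] in E'.
      transitivity ((a * d - b * c) * (d * R (S k) (S n) + - b * R (S k) n)
                    + b * ((a * d - b * c) * R (S k) n)); [ring|].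
      rewrite E', IHn.
      transitivity (- c * ((a * d - b * c) * R k (S n)) + a * ((a * d - b * c) * R k n)
                    + b * P (S n) (S (S k))); [ring|].
      rewrite !IHk.
      transitivity (d * P (S (S n)) (S (S k)) + c * P (S (S n)) (S k) - c * P (S (S n)) (S k)); [|ring].
      rewrite E; ring.
Qed.

(** The coefficient of [z^n] in [(sigma^(k+1))' = (k+1) sigma^k sigma'] is read off in two ways.
    Conjugations are restored later by inserting the conjugates of [a], [b], [c], [d]. *)
Lemma lft_coef_adjoint (a b c d : C) (k n : nat) :
  d <> RtoC 0%R ->
  RtoC (INR (S n)) * lft_coef a (- c) (- b) d (S k) (S n)
  = RtoC (INR (S k)) * lft_coef a b c d (S n) (S k).
Proof.
  intros HD.
  change (lder (lft_coef a (- c) (- b) d (S k)) n = RtoC (INR (S k)) * lft_coef a b c d (S n) (S k)).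
  rewrite lder_lft_coef, <- lft_coef_adjoint_deriv by assumption; ring.
Qed.

Lemma Cconj_RtoC (x : R) : Cconj (RtoC x) = RtoC x.
Proof. unfold Cconj, RtoC; simpl; f_equal; ring. Qed.

Lemma lft_coef_conj (a b c d : C) (k n : nat) :
  d <> RtoC 0%R ->
  Cconj (lft_coef a b c d k n) = lft_coef (Cconj a) (Cconj b) (Cconj c) (Cconj d) k n.
Proof.
  intros HD; revert n; induction k as [|k IHk]; intros n.
  - destruct n; apply Cconj_RtoC.
  - assert (Hdiv : forall n, Cconj (ldiv c d (lft_coef a b c d k) n) =
      ldiv (Cconj c) (Cconj d) (lft_coef (Cconj a) (Cconj b) (Cconj c) (Cconj d) k) n).
    { intros m; induction m as [|m IHm]; cbn [ldiv].
      - now rewrite Cdiv_conj, IHk.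
      - now rewrite Cdiv_conj, Cminus_conj, Cmult_conj, IHk, IHm. }
    destruct n; cbn [lft_coef lmul];
      now rewrite ?Cplus_conj, ?Cmult_conj, ?Hdiv.
Qed.

(** * Geometric bounds for the coefficients *)

Fixpoint psum (u : nat -> R) (n : nat) : R :=
  match n with O => 0%R | S k => (psum u k + u k)%R end.

Lemma psum_pos (u : nat -> R) (n : nat) :
  (forall k, (0 <= u k)%R) -> (0 <= psum u n)%R.
Proof.
  intros H; induction n as [|n IHn]; simpl; [lra|specialize (H n); lra].
Qed.

Lemma psum_cons (u : nat -> R) (n : nat) :
  psum u (S n) = (u O + psum (fun k => u (S k)) n)%R.
Proof. induction n as [|n IHn]; simpl in *; [ring|rewrite IHn; ring]. Qed.

Lemma Cmod2_plus (u v : C) :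
  (Cmod (u + v) ^ 2 = Cmod u ^ 2 + Cmod v ^ 2 + 2 * Re (u * Cconj v))%R.
Proof. rewrite !Cmod2_alt; destruct u, v; unfold Re, Im; simpl; ring. Qed.

Lemma Cpolar (z : C) : exists w, Cmod w = 1%R /\ z = RtoC (Cmod z) * w.
Proof.
  destruct (Req_dec (Cmod z) 0) as [H|H].
  - exists (RtoC 1%R); split; [apply Cmod_1|].
    rewrite H, (Cmod_eq_0 z H); ring.
  - assert (H' : RtoC (Cmod z) <> RtoC 0%R) by (intros E; apply H; now injection E).
    exists (z / RtoC (Cmod z)); split.
    + rewrite Cmod_div, Cmod_R, Rabs_pos_eq by (auto using Cmod_ge_0); field; exact H.
    + field; exact H'.
Qed.

Lemma Re_scal (x : R) (z : C) : Re (RtoC x * z) = (x * Re z)%R.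
Proof. destruct z; unfold Re; simpl; ring. Qed.

Lemma fsum_cauchy_schwarz (u v : nat -> C) (n : nat) :
  (Cmod (fsum n (fun j => (u j * Cconj (v j))%C)) ^ 2
   <= psum (fun j => Cmod (u j) ^ 2) n * psum (fun j => Cmod (v j) ^ 2) n)%R.
Proof.
  induction n as [|n IHn]; cbn [fsum psum]; [rewrite Cmod_0; simpl; lra|].
  set (y := fsum n _) in *.
  assert (HG : (0 <= psum (fun j => Cmod (u j) ^ 2) n)%R)
    by (apply psum_pos; intros; apply pow2_ge_0).
  assert (HH : (0 <= psum (fun j => Cmod (v j) ^ 2) n)%R)
    by (apply psum_pos; intros; apply pow2_ge_0).
  set (G := psum (fun j => Cmod (u j) ^ 2)%R n) in *.
  set (H := psum (fun j => Cmod (v j) ^ 2)%R n) in *.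
  assert (Ht : (Cmod (y + u n * Cconj (v n)) <= Cmod y + Cmod (u n) * Cmod (v n))%R).
  { eapply Rle_trans; [apply Cmod_triangle|]; rewrite Cmod_mult, Cmod_conj; lra. }
  assert (Hp := Cmod_ge_0 (y + u n * Cconj (v n))).
  assert (Hm := Cmod_ge_0 y); assert (Hu := Cmod_ge_0 (u n)); assert (Hv := Cmod_ge_0 (v n)).
  set (m := Cmod y) in *; set (x := Cmod (u n)) in *; set (w := Cmod (v n)) in *.
  set (s := Cmod (y + u n * Cconj (v n))) in *; clearbody G H s m x w.
  (* Squared: [m^2 <= G H] by induction, and [4 G H (x w)^2 <= (G w^2 + H x^2)^2] by the
     arithmetic-geometric mean inequality. *)
  assert (Hc : (2 * m * (x * w) <= G * w ^ 2 + H * x ^ 2)%R).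
  { assert (Hxw : (0 <= x * w)%R) by now apply Rmult_le_pos.
    apply Rsqr_incr_0_var; [unfold Rsqr|nra].
    apply Rle_trans with (4 * (G * H) * (x * w) ^ 2)%R.
    - assert (0 <= (x * w) ^ 2)%R by apply pow2_ge_0; nra.
    - assert (0 <= (G * w ^ 2 - H * x ^ 2) ^ 2)%R by apply pow2_ge_0; nra. }
  apply Rle_trans with ((m + x * w) ^ 2)%R; [apply pow_incr; lra|nra].
Qed.

(** Expansion of [|q h_(j+1) + p h_j|^2]: the shifted copy of [h] loses its last entry, hence the
    shorter sum, and the cross terms form the correlation of [h] with its shift. *)
Lemma psum_lmul (p q : C) (h : nat -> C) (n : nat) :
  (psum (fun j => Cmod (lmul p q h j) ^ 2) (S n)
   = Cmod q ^ 2 * psum (fun j => Cmod (h j) ^ 2) (S n)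
     + Cmod p ^ 2 * psum (fun j => Cmod (h j) ^ 2) n
     + 2 * Re (q * Cconj p * fsum n (fun j => (h (S j) * Cconj (h j))%C)))%R.
Proof.
  induction n as [|n IHn].
  - simpl psum; simpl fsum; rewrite Cmult_0_r, Cmod_mult; unfold Re; simpl; ring.
  - cbn [psum] in *; rewrite IHn; cbn [fsum lmul].
    set (y := fsum n _); rewrite Cmod2_plus, !Cmod_mult, Cmult_plus_distr_l.
    replace (q * h (S n) * Cconj (p * h n))
      with (q * Cconj p * (h (S n) * Cconj (h n))) by (rewrite Cmult_conj; ring).
    unfold Re; simpl fst; ring.
Qed.

(* [h |-> (a z + b) h] is dominated by [s (c z + d) h] in the Hardy norm of every
   truncation: expanding the squares leaves a form in the two partial norms and the
   correlation of [h] with its shift, nonnegative by Cauchy-Schwarz and the hypothesis at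
   the points of modulus equal to the ratio of the partial norms. *)
Lemma psum_lmul_le (a b c d : C) (s : R) (h : nat -> C) (n : nat) :
  (forall z, (Cmod z <= 1)%R -> (Cmod (a * z + b) <= s * Cmod (c * z + d))%R) ->
  (psum (fun j => Cmod (lmul a b h j) ^ 2) n
   <= s ^ 2 * psum (fun j => Cmod (lmul c d h j) ^ 2) n)%R.
Proof.
  intros Hs; destruct n as [|n]; [simpl; lra|].
  rewrite !psum_lmul.
  set (y := fsum n _).
  assert (Hcs := fsum_cauchy_schwarz (fun j => h (S j)) h n); fold y in Hcs.
  set (G := psum (fun j => Cmod (h (S j)) ^ 2)%R n) in Hcs.
  assert (HX : psum (fun j => Cmod (h j) ^ 2)%R (S n) = (Cmod (h O) ^ 2 + G)%R)
    by apply psum_cons.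
  assert (Hle : (psum (fun j => Cmod (h j) ^ 2)%R n <= psum (fun j => Cmod (h j) ^ 2)%R (S n))%R)
    by (cbn [psum]; assert (H := pow2_ge_0 (Cmod (h n))); lra).
  assert (HY0 : (0 <= psum (fun j => Cmod (h j) ^ 2)%R n)%R)
    by (apply psum_pos; intros; apply pow2_ge_0).
  assert (HG : (G <= psum (fun j => Cmod (h j) ^ 2)%R (S n))%R)
    by (rewrite HX; assert (H := pow2_ge_0 (Cmod (h O))); lra).
  clear HX.
  set (X := psum (fun j => Cmod (h j) ^ 2)%R (S n)) in *.
  set (Y := psum (fun j => Cmod (h j) ^ 2)%R n) in *.
  assert (Hcs' : (Cmod y ^ 2 <= X * Y)%R) by (eapply Rle_trans; [apply Hcs|]; nra).
  clearbody X Y y; clear Hcs HG G.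
  destruct (Rle_lt_or_eq_dec 0 X) as [HXp|HX0]; [lra| |].
  2:{ assert (HYz : Y = 0%R) by lra.
      assert (Hy : y = RtoC 0%R).
      { apply Cmod_eq_0; assert (H := Cmod_ge_0 y); nra. }
      rewrite Hy, HYz, <- HX0, !Cmult_0_r; simpl; lra. }
  set (x := sqrt X); set (v := sqrt Y).
  assert (Hx : (0 < x)%R) by (now apply sqrt_lt_R0).
  assert (Hv : (0 <= v)%R) by apply sqrt_pos.
  assert (HxX : (X = x ^ 2)%R) by (unfold x; rewrite pow2_sqrt; lra).
  assert (HvY : (Y = v ^ 2)%R) by (unfold v; rewrite pow2_sqrt; lra).
  assert (Hvx : (v <= x)%R) by (apply sqrt_le_1; lra).
  clearbody x v; subst X Y.
  destruct (Cpolar y) as [w [Hw Hyw]].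
  set (m := Cmod y) in *; assert (Hm : (0 <= m)%R) by apply Cmod_ge_0.
  assert (Hmx : (m <= x * v)%R).
  { apply Rsqr_incr_0_var; [unfold Rsqr; nra|nra]. }
  (* For [t = 1] and [t = -1] the hypothesis is taken at [z = t (v / x) conj w], in the closed disk
     since [v <= x]. Squared and multiplied by [x^2], it is the desired inequality with [m] replaced
     by [t x v]. *)
  assert (key : forall t : R, (t ^ 2 = 1)%R ->
    (Cmod b ^ 2 * x ^ 2 + Cmod a ^ 2 * v ^ 2 + 2 * (t * (x * v)) * Re (b * Cconj a * w)
     <= s ^ 2 * (Cmod d ^ 2 * x ^ 2 + Cmod c ^ 2 * v ^ 2
                 + 2 * (t * (x * v)) * Re (d * Cconj c * w)))%R).
  { intros t Ht.
    assert (ex : forall p q : C,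
      (Cmod (p * (RtoC (t * v / x) * Cconj w) + q) ^ 2 * x ^ 2
       = Cmod q ^ 2 * x ^ 2 + Cmod p ^ 2 * v ^ 2 + 2 * (t * (x * v)) * Re (q * Cconj p * w))%R).
    { intros p q; rewrite Cplus_comm, Cmod2_plus, !Cmod_mult, Cmod_conj, Hw, Cmod_R.
      replace (q * Cconj (p * (RtoC (t * v / x) * Cconj w)))
        with (RtoC (t * v / x) * (q * Cconj p * w)).
      - rewrite Re_scal, Rmult_1_r, Rpow_mult_distr, pow2_abs.
        transitivity (Cmod q ^ 2 * x ^ 2 + Cmod p ^ 2 * (t ^ 2 * v ^ 2)
                      + 2 * (t * (x * v)) * Re (q * Cconj p * w))%R; [field; lra|].
        rewrite Ht; ring.
      - rewrite !Cmult_conj, Cconj_conj.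
        rewrite Cconj_RtoC; ring. }
    rewrite <- !ex.
    assert (Hz : (Cmod (RtoC (t * v / x) * Cconj w) <= 1)%R).
    { rewrite Cmod_mult, Cmod_conj, Hw, Cmod_R, Rmult_1_r.
      apply Rabs_le.
      assert (Hvx1 : (0 <= v / x <= 1)%R).
      { split; [apply Rmult_le_pos; [lra|left; now apply Rinv_0_lt_compat]|].
        apply Rmult_le_reg_r with x; [lra|]; unfold Rdiv; rewrite Rmult_assoc, Rinv_l; lra. }
      replace (t * v / x)%R with (t * (v / x))%R by (unfold Rdiv; ring).
      assert (Ht2 : t = 1%R \/ t = (-1)%R).
      { destruct (Req_dec t 1); [now left|right].
        apply Rmult_eq_reg_l with (t - 1)%R; lra. }
      destruct Ht2; subst t; lra. }
    specialize (Hs _ Hz).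
    rewrite <- Rmult_assoc; apply Rmult_le_compat_r; [apply pow2_ge_0|].
    rewrite <- Rpow_mult_distr; apply pow_incr; split; [apply Cmod_ge_0|exact Hs]. }
  assert (k1 := key 1%R ltac:(lra)); assert (k2 := key (-1)%R ltac:(lra)); clear key.
  rewrite Hyw.
  replace (b * Cconj a * (RtoC m * w)) with (RtoC m * (b * Cconj a * w)) by ring.
  replace (d * Cconj c * (RtoC m * w)) with (RtoC m * (d * Cconj c * w)) by ring.
  rewrite !Re_scal.
  set (r1 := Re (b * Cconj a * w)) in *; set (r2 := Re (d * Cconj c * w)) in *.
  set (e1 := (Cmod b ^ 2 * x ^ 2 + Cmod a ^ 2 * v ^ 2)%R) in *.
  set (e2 := (Cmod d ^ 2 * x ^ 2 + Cmod c ^ 2 * v ^ 2)%R) in *.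
  clearbody r1 r2 e1 e2.
  (* An affine function that is nonnegative at [x v] and at [- x v] is nonnegative at [m], which
     lies between them. *)
  assert (k : forall g, (0 <= s ^ 2 * e2 - e1 + (x * v) * g)%R ->
     (0 <= s ^ 2 * e2 - e1 - (x * v) * g)%R -> (0 <= s ^ 2 * e2 - e1 + m * g)%R).
  { intros g; destruct (Rle_dec 0 g); nra. }
  specialize (k (2 * (s ^ 2 * r2 - r1))%R ltac:(lra) ltac:(lra)); lra.
Qed.

(** Each factor [phi] contracts by [s]: with [h = phi^k / (c z + d)], the product
    [phi^(k+1) = (a z + b) h] is dominated by [s (c z + d) h = s phi^k]. The induction starts at the
    constant 1. *)
Lemma psum_lft_coef (a b c d : C) (s : R) (k n : nat) :
  d <> RtoC 0%R ->
  (forall z, (Cmod z <= 1)%R -> (Cmod (a * z + b) <= s * Cmod (c * z + d))%R) ->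
  (psum (fun j => Cmod (lft_coef a b c d k j) ^ 2) n <= (s ^ k) ^ 2)%R.
Proof.
  intros Hd Hs; induction k as [|k IHk].
  - destruct n as [|n]; [simpl; lra|].
    rewrite psum_cons; simpl lft_coef; rewrite Cmod_1.
    replace (psum _ n) with 0%R; [simpl; lra|].
    induction n as [|n IHn]; [reflexivity|].
    cbn [psum]; rewrite <- IHn, Cmod_0; simpl; ring.
  - cbn [lft_coef]; eapply Rle_trans; [apply psum_lmul_le, Hs|].
    rewrite lmul_ldiv by assumption.
    replace ((s ^ S k) ^ 2)%R with (s ^ 2 * (s ^ k) ^ 2)%R by (simpl; ring).
    apply Rmult_le_compat_l; [apply pow2_ge_0|exact IHk].
Qed.

(** One coefficient is at most the truncated l^2 norm; this replaces Cauchy's estimate on the unit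
    circle. *)
Lemma lft_coef_le (a b c d : C) (s : R) (k n : nat) :
  (0 <= s)%R -> d <> RtoC 0%R ->
  (forall z, (Cmod z <= 1)%R -> (Cmod (a * z + b) <= s * Cmod (c * z + d))%R) ->
  (Cmod (lft_coef a b c d k n) <= s ^ k)%R.
Proof.
  intros Hs0 Hd Hs.
  assert (H := psum_lft_coef a b c d s k (S n) Hd Hs); cbn [psum] in H.
  assert (H0 : (0 <= psum (fun j => Cmod (lft_coef a b c d k j) ^ 2) n)%R)
    by (apply psum_pos; intros; apply pow2_ge_0).
  apply Rsqr_incr_0_var; [unfold Rsqr; nra|now apply pow_le].
Qed.

Lemma lft_coef_rescale (a b c d t : C) (k n : nat) :
  d <> RtoC 0%R ->
  lft_coef (a * t) b (c * t) d k n = lft_coef a b c d k n * t ^ n.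
Proof.
  intros Hd; revert n; induction k as [|k IHk]; intros n.
  - destruct n; simpl; ring.
  - assert (Hdiv : forall n, ldiv (c * t) d (lft_coef (a * t) b (c * t) d k) n
                             = ldiv c d (lft_coef a b c d k) n * t ^ n).
    { intros m; induction m as [|m IHm]; cbn [ldiv].
      - rewrite IHk; simpl; field; exact Hd.
      - rewrite IHk, IHm; simpl; field; exact Hd. }
    destruct n; cbn [lft_coef lmul]; rewrite ?Hdiv; simpl; ring.
Qed.

Lemma Rinv_unit_interval (T : R) : (1 < T)%R -> (0 < / T < 1)%R.
Proof.
  intros HT; split; [apply Rinv_0_lt_compat; lra|].
  rewrite <- Rinv_1; apply Rinv_lt_contravar; lra.
Qed.

(** The preceding bound with [s = 1/T] is applied to [phi(T z)], whose coefficients carry the extra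
    factor [T^n]. *)
Lemma lft_coef_geom (a b c d : C) (T : R) (k n : nat) :
  (1 < T)%R -> d <> RtoC 0%R ->
  (forall z, (Cmod z <= T)%R -> (T * Cmod (a * z + b) <= Cmod (c * z + d))%R) ->
  (Cmod (lft_coef a b c d k n) <= (/ T) ^ n * (/ T) ^ k)%R.
Proof.
  intros HT Hd H.
  assert (HTi : (0 < / T)%R) by (apply Rinv_0_lt_compat; lra).
  assert (Hb := lft_coef_le (a * RtoC T) b (c * RtoC T) d (/ T) k n ltac:(lra) Hd).
  rewrite lft_coef_rescale, Cmod_mult, Cmod_pow, Cmod_R, Rabs_pos_eq in Hb by (assumption || lra).
  rewrite pow_inv; apply Rmult_le_reg_l with (T ^ n)%R; [apply pow_lt; lra|].
  rewrite <- Rmult_assoc, Rinv_r, Rmult_1_l, Rmult_comm by (apply pow_nonzero; lra).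
  apply Hb; intros z Hz.
  rewrite <- !Cmult_assoc.
  apply Rmult_le_reg_l with T; [lra|].
  rewrite <- Rmult_assoc, Rinv_r, Rmult_1_l by lra.
  apply H; rewrite Cmod_mult, Cmod_R, Rabs_pos_eq by lra.
  assert (Hz0 := Cmod_ge_0 z); nra.
Qed.

(** * Extension of phi and sigma beyond the unit disk *)

Lemma Cmod_triangle_rev (u v : C) : (Cmod u - Cmod v <= Cmod (u + v))%R.
Proof.
  assert (H := Cmod_triangle (u + v) (- v)); rewrite Cmod_opp in H.
  replace (u + v + - v) with u in H by ring; lra.
Qed.

(** Since [a d - b c = a (c z + d) - c (a z + b)], the denominator is bounded away from 0 on the
    disk, so the slack in [|a z + b| <= r |c z + d|] survives a small move out of the disk.
    Strictness serves the bound for [sigma]. *)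
Lemma lft_extend (a b c d : C) (r : R) :
  a * d - b * c <> RtoC 0%R ->
  (forall z, in_disk z -> c * z + d <> RtoC 0%R) -> (r < 1)%R ->
  (forall z, in_disk z -> (Cmod (lft a b c d z) <= r)%R) ->
  exists T : R, (1 < T)%R /\
    forall z, (Cmod z <= T)%R -> (T * Cmod (a * z + b) < Cmod (c * z + d))%R.
Proof.
  intros Hdet Hden Hr Hphi.
  assert (Hb : forall z, in_disk z -> (Cmod (a * z + b) <= r * Cmod (c * z + d))%R).
  { intros z Hz; specialize (Hphi z Hz); specialize (Hden z Hz).
    unfold lft in Hphi; rewrite Cmod_div in Hphi by assumption.
    apply Cmod_gt_0 in Hden.
    apply Rmult_le_reg_r with (/ Cmod (c * z + d))%R; [now apply Rinv_0_lt_compat|].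
    rewrite Rmult_assoc, Rinv_r by lra; lra. }
  assert (Hr0 : (0 <= r)%R).
  { eapply Rle_trans; [apply Cmod_ge_0|apply (Hphi (RtoC 0%R))].
    unfold in_disk; rewrite Cmod_0; lra. }
  assert (Ha := Cmod_ge_0 a); assert (Hc := Cmod_ge_0 c).
  set (D := Cmod (a * d - b * c)).
  assert (HD : (0 < D)%R) by (now apply Cmod_gt_0).
  assert (Hlow : forall z, in_disk z -> (D <= (Cmod a + Cmod c) * Cmod (c * z + d))%R).
  { intros z Hz; unfold D.
    replace (a * d - b * c) with (a * (c * z + d) + - (c * (a * z + b))) by ring.
    eapply Rle_trans; [apply Cmod_triangle|]; rewrite Cmod_opp, !Cmod_mult.
    specialize (Hb z Hz); assert (H := Cmod_ge_0 (c * z + d)).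
    assert (Cmod c * Cmod (a * z + b) <= Cmod c * Cmod (c * z + d))%R by
      (apply Rmult_le_compat_l; nra); nra. }
  assert (Hac : (0 < Cmod a + Cmod c)%R).
  { assert (H := Hlow (RtoC 0%R)); unfold in_disk in H; rewrite Cmod_0 in H.
    specialize (H ltac:(lra)); assert (H' := Cmod_ge_0 (c * RtoC 0%R + d)); nra. }
  set (S := (Cmod a + Cmod c)%R) in *.
  (* The first bound gives [T r <= (1 + r) / 2] and [T <= 3/2]. The second, with [D <= S |c w + d|],
     gives [13 e S <= |c w + d| (1 - r)], so half of the right side exceeds the perturbation error
     [6 e S]. *)
  set (e := Rmin ((1 - r) / 2) (D * (1 - r) / (13 * S * S))).
  assert (He1 : (e <= (1 - r) / 2)%R) by apply Rmin_l.
  assert (He2 : (e * (13 * S * S) <= D * (1 - r))%R).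
  { apply Rle_trans with (D * (1 - r) / (13 * S * S) * (13 * S * S))%R.
    - apply Rmult_le_compat_r; [nra|apply Rmin_r].
    - right; field; lra. }
  assert (He : (0 < e)%R).
  { apply Rmin_glb_lt; [lra|].
    apply Rmult_lt_0_compat; [nra|apply Rinv_0_lt_compat; nra]. }
  exists (1 + e)%R; split; [lra|]; intros z Hz.
  set (T := (1 + e)%R) in *; assert (HT : (1 < T)%R) by (unfold T; lra).
  (* [|w| <= 1/T < 1], and [z - w = (T^2 - 1) w] has modulus at most [2 e + e^2 <= 3 e]. *)
  set (w := RtoC (/ (T * T)) * z).
  assert (Hzw : z = RtoC (T * T) * w).
  { unfold w; rewrite Cmult_assoc, <- RtoC_mult, Rinv_r by nra; ring. }
  assert (Hw : (T * Cmod w <= 1)%R).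
  { assert (Ez : Cmod z = (T * T * Cmod w)%R)
      by (rewrite Hzw, Cmod_mult, Cmod_R, Rabs_pos_eq by nra; reflexivity).
    apply Rmult_le_reg_l with T; [lra|]; nra. }
  assert (Hw0 := Cmod_ge_0 w).
  assert (Hwd : in_disk w) by (unfold in_disk; nra).
  specialize (Hb w Hwd); specialize (Hlow w Hwd).
  set (g := RtoC (T * T - 1) * w).
  assert (Hg : (Cmod g <= 3 * e)%R).
  { unfold g; rewrite Cmod_mult, Cmod_R, Rabs_pos_eq by nra.
    unfold in_disk in Hwd; assert (0 < T * T - 1)%R by nra.
    apply Rle_trans with (T * T - 1)%R; [nra|unfold T; nra]. }
  assert (Hg0 := Cmod_ge_0 g).
  assert (Ezg : z = w + g).
  { rewrite Hzw at 1; unfold g; rewrite RtoC_minus; ring. }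
  assert (N : (Cmod (a * z + b) <= Cmod (a * w + b) + Cmod a * (3 * e))%R).
  { rewrite Ezg; replace (a * (w + g) + b) with (a * w + b + a * g) by ring.
    eapply Rle_trans; [apply Cmod_triangle|]; rewrite Cmod_mult; nra. }
  assert (M : (Cmod (c * w + d) - Cmod c * (3 * e) <= Cmod (c * z + d))%R).
  { rewrite Ezg; replace (c * (w + g) + d) with (c * w + d + c * g) by ring.
    eapply Rle_trans; [|apply Cmod_triangle_rev]; rewrite Cmod_mult; nra. }
  set (m := Cmod (c * w + d)) in *.
  set (x := Cmod (a * w + b)) in *.
  assert (Hm : (0 <= m)%R) by apply Cmod_ge_0.
  assert (HTx : (T * Cmod (a * z + b) <= T * (r * m + Cmod a * (3 * e)))%R)
    by (apply Rmult_le_compat_l; lra).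
  eapply Rle_lt_trans; [exact HTx|]; eapply Rlt_le_trans; [|exact M].
  clearbody m x D; clear N M HTx Hb Hg Hg0 Ezg Hw Hw0 Hzw.
  assert (HTr : (T * r <= (1 + r) / 2)%R) by (unfold T; assert (e * r <= e)%R by nra; lra).
  assert (HT2 : (T <= 3 / 2)%R) by (unfold T; lra).
  assert (Hgap : (T * (Cmod a * (3 * e)) + Cmod c * (3 * e) <= 6 * e * S)%R).
  { unfold S; assert (0 <= Cmod a * e)%R by nra; nra. }
  assert (Hm2 : (13 * e * S <= m * (1 - r))%R).
  { apply Rmult_le_reg_r with S; [lra|]; nra. }
  assert (Hm3 : (T * (r * m) <= (1 + r) / 2 * m)%R) by nra.
  assert (0 < e * S)%R by nra.
  nra.
Qed.

(* If [T |a w - c| > |d - b w|], then [z = (d - b w) / (a w - c)] satisfies [|z| < T] and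
   [w (a z + b) = c z + d]. *)
Lemma krein_adjoint_bound (a b c d : C) (T : R) :
  (forall z, (Cmod z <= T)%R -> (T * Cmod (a * z + b) < Cmod (c * z + d))%R) ->
  forall w, (Cmod w <= T)%R ->
  (T * Cmod (Cconj a * w + - Cconj c) <= Cmod (- Cconj b * w + Cconj d))%R.
Proof.
  intros H w' Hw'; set (w := Cconj w').
  assert (Hw : (Cmod w <= T)%R) by (unfold w; now rewrite Cmod_conj).
  rewrite <- (Cmod_conj (Cconj a * w' + _)), <- (Cmod_conj (_ + Cconj d)).
  rewrite !Cplus_conj, !Cmult_conj, !Copp_conj, !Cconj_conj; fold w.
  apply Rnot_lt_le; intros Hlt.
  assert (Hpos : (0 < Cmod (a * w + - c))%R).
  { assert (H1 := Cmod_ge_0 (- b * w + d)); assert (H2 := Cmod_ge_0 (a * w + - c)).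
    assert (H3 := Cmod_ge_0 w); nra. }
  assert (Hnz : a * w + - c <> RtoC 0%R) by (now apply Cmod_gt_0).
  set (z := (- b * w + d) / (a * w + - c)).
  assert (Hz : (Cmod z <= T)%R).
  { unfold z; rewrite Cmod_div by assumption.
    apply Rmult_le_reg_r with (Cmod (a * w + - c)); [assumption|].
    unfold Rdiv; rewrite Rmult_assoc, Rinv_l; lra. }
  assert (E : c * z + d = w * (a * z + b)) by (unfold z; field; exact Hnz).
  specialize (H z Hz); rewrite E, Cmod_mult in H.
  assert (H2 := Cmod_ge_0 (a * z + b)); nra.
Qed.


(** * Power series of weighted composition operators *)

Lemma coef_eq (f : C -> C) (u : nat -> C) : has_coefs f u -> coef f = u.
Proof.
  intros H; apply functional_extensionality; intros n.
  apply has_coefs_unique with f; [|exact H].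
  unfold coef; apply epsilon_spec; exists u; exact H.
Qed.

Lemma in_S_coef (f : C -> C) :
  in_S f -> has_coefs f (coef f) /\ ex_series (fun n => (weight n * Cmod (coef f n) ^ 2)%R).
Proof. intros [u [Hu Hs]]; now rewrite (coef_eq f u Hu). Qed.

Lemma has_coefs_plus (f g : C -> C) (u v : nat -> C) :
  has_coefs f u -> has_coefs g v -> has_coefs (fun z => f z + g z) (fun n => u n + v n).
Proof.
  intros Hf Hg z Hz; apply cseries_ext with (fun n => u n * z ^ n + v n * z ^ n).
  - intros n; ring.
  - apply cseries_plus; [now apply Hf|now apply Hg].
Qed.

Lemma has_coefs_scal (l : C) (f : C -> C) (u : nat -> C) :
  has_coefs f u -> has_coefs (fun z => l * f z) (fun n => l * u n).
Proof.
  intros Hf z Hz; apply cseries_ext with (fun n => l * (u n * z ^ n)).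
  - intros n; ring.
  - apply cseries_scal, Hf, Hz.
Qed.

(** * Weights, the norm and geometric majorants *)

Lemma weight_ge_1 (n : nat) : (1 <= weight n)%R.
Proof.
  destruct n as [|[|n]]; cbn [weight]; [lra|lra|].
  replace (S (S n) - 1)%nat with (S n) by lia.
  rewrite (S_INR (S n)), S_INR; assert (H := pos_INR n); nra.
Qed.

Lemma weight_SS (n : nat) : weight (S (S n)) = (INR (S (S n)) * INR (S n))%R.
Proof. cbn [weight]; now replace (S (S n) - 1)%nat with (S n) by lia. Qed.

Lemma weight_le (n : nat) : (weight (S n) <= INR (S n) ^ 2)%R.
Proof.
  destruct n as [|n]; [simpl; lra|].
  rewrite weight_SS, (S_INR (S n)); assert (H := pos_INR (S n)); nra.
Qed.

Lemma Snorm_eq (f : C -> C) :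
  in_S f -> Snorm f = sqrt (Series (fun n => (weight n * Cmod (coef f n) ^ 2)%R)).
Proof.
  intros Hf; destruct (in_S_coef f Hf) as [_ Hs].
  unfold Snorm, ip.
  rewrite (csum_eq _ (RtoC (Series (fun n => (weight n * Cmod (coef f n) ^ 2)%R)))); [reflexivity|].
  apply cseries_ext with (fun n => RtoC (weight n * Cmod (coef f n) ^ 2)%R).
  - intros n; rewrite RtoC_mult, Cmod2_conj; ring.
  - apply cseries_RtoC, Series_correct, Hs.
Qed.

Lemma Snorm_pos (f : C -> C) : (0 <= Snorm f)%R.
Proof. apply sqrt_pos. Qed.

Lemma series_term_le (u : nat -> R) (n : nat) :
  (forall k, (0 <= u k)%R) -> ex_series u -> (u n <= Series u)%R.
Proof.
  intros Hu Hs.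
  apply Rle_trans with (sum_n u n).
  - destruct n; [rewrite sum_O; lra|].
    rewrite sum_Sn; change (u (S n) <= sum_n u n + u (S n))%R.
    assert (0 <= sum_n u n)%R; [|lra].
    clear - Hu; induction n; [rewrite sum_O; auto|].
    rewrite sum_Sn; change (0 <= sum_n u n + u (S n))%R.
    specialize (Hu (S n)); lra.
  - apply (is_lim_seq_incr_compare (sum_n u) (Series u) (Series_correct u Hs)).
    intros k; rewrite sum_Sn; change (sum_n u k <= sum_n u k + u (S k))%R.
    specialize (Hu (S k)); lra.
Qed.

Lemma coef_le_Snorm (f : C -> C) (n : nat) : in_S f -> (Cmod (coef f n) <= Snorm f)%R.
Proof.
  intros Hf; rewrite Snorm_eq by assumption.
  rewrite <- (sqrt_pow2 (Cmod (coef f n))) by apply Cmod_ge_0.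
  apply sqrt_le_1_alt.
  eapply Rle_trans; [|apply (series_term_le (fun n => (weight n * Cmod (coef f n) ^ 2)%R) n)].
  - assert (H := weight_ge_1 n); assert (H' := pow2_ge_0 (Cmod (coef f n))); nra.
  - intros k; apply Rmult_le_pos; [|apply pow2_ge_0].
    assert (H := weight_ge_1 k); lra.
  - now apply in_S_coef.
Qed.

(** Bernoulli's inequality [(1 + e)^n >= 1 + n e] absorbs the linear factor into a larger ratio. *)
Lemma linear_geom (q : R) :
  (0 < q < 1)%R -> exists p M, (q < p < 1)%R /\ (0 < M)%R /\
    forall n, (INR (S n) * q ^ n <= M * p ^ n)%R.
Proof.
  (* Chosen so that [q (1 + e) = (1 + q) / 2]. *)
  intros Hq; set (e := ((1 - q) / (2 * q))%R).
  assert (He : (0 < e)%R) by (apply Rdiv_lt_0_compat; lra).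
  assert (Hei : (0 < / e)%R) by now apply Rinv_0_lt_compat.
  exists (q * (1 + e))%R, (1 + / e)%R; repeat split.
  - nra.
  - replace (q * (1 + e))%R with ((1 + q) / 2)%R by (unfold e; field; lra); lra.
  - lra.
  - intros n; rewrite Rpow_mult_distr.
    assert (Hb := poly n e He); assert (Hp := pow_lt q n ltac:(lra)).
    assert (Hn := pos_INR n).
    assert (H : (INR (S n) <= (1 + / e) * (1 + e) ^ n)%R).
    { apply Rle_trans with ((1 + / e) * (1 + INR n * e))%R; [|apply Rmult_le_compat_l; lra].
      rewrite S_INR; replace ((1 + / e) * (1 + INR n * e))%R
        with (INR n + 1 + (INR n * e + / e))%R by (field; lra); nra. }
    replace ((1 + / e) * (q ^ n * (1 + e) ^ n))%R
      with ((1 + / e) * (1 + e) ^ n * q ^ n)%R by ring.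
    apply Rmult_le_compat_r; lra.
Qed.

Lemma quadratic_geom (q : R) :
  (0 < q < 1)%R -> exists p M, (q < p < 1)%R /\ (0 < M)%R /\
    forall n, (INR (S n) ^ 2 * q ^ n <= M * p ^ n)%R.
Proof.
  intros Hq; destruct (linear_geom q Hq) as [p [M [Hp [HM H]]]].
  destruct (linear_geom p ltac:(lra)) as [p' [M' [Hp' [HM' H']]]].
  exists p', (M * M')%R; repeat split; [lra|lra|nra|].
  intros n; specialize (H n); specialize (H' n); assert (Hn := pos_INR (S n)).
  apply Rle_trans with (INR (S n) * (M * p ^ n))%R; [|nra].
  replace (INR (S n) ^ 2 * q ^ n)%R with (INR (S n) * (INR (S n) * q ^ n))%R by ring.
  now apply Rmult_le_compat_l.
Qed.

(** [N] depends on [q] only, which turns coefficient bounds into operator bounds. The weights are at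
    most [(n+1)^2], absorbed by a larger ratio. *)
Lemma in_S_geom (q : R) :
  (0 < q < 1)%R -> exists N, (0 <= N)%R /\
    forall (f : C -> C) (u : nat -> C) (m : R), (0 <= m)%R ->
    has_coefs f u -> (forall n, (Cmod (u n) <= m * q ^ n)%R) ->
    in_S f /\ (Snorm f <= N * m)%R.
Proof.
  intros Hq; destruct (quadratic_geom q Hq) as [p [M [Hp [HM H]]]].
  exists (sqrt (M / (1 - p))); split; [apply sqrt_pos|].
  intros f u m Hm Hu Hle.
  assert (Hw : forall n, (0 <= weight n * Cmod (u n) ^ 2 <= m ^ 2 * M * p ^ n)%R).
  { intros n; assert (H1 := weight_ge_1 n); assert (H2 := pow2_ge_0 (Cmod (u n))).
    split; [nra|].
    assert (H3 : (weight n <= INR (S n) ^ 2)%R).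
    { destruct n; [simpl; lra|]; eapply Rle_trans; [apply weight_le|].
      apply pow_incr; rewrite (S_INR (S n)); assert (H4 := pos_INR (S n)); lra. }
    assert (Hqn : (0 < q ^ n <= 1)%R).
    { split; [apply pow_lt; lra|].
      rewrite <- (pow1 n); apply pow_incr; lra. }
    assert (H4 : (Cmod (u n) ^ 2 <= m ^ 2 * q ^ n)%R).
    { apply Rle_trans with ((m * q ^ n) ^ 2)%R.
      - apply pow_incr; split; [apply Cmod_ge_0|apply Hle].
      - assert (H5 := pow2_ge_0 m); rewrite Rpow_mult_distr; apply Rmult_le_compat_l; nra. }
    apply Rle_trans with (INR (S n) ^ 2 * (m ^ 2 * q ^ n))%R.
    - apply Rmult_le_compat; lra.
    - replace (INR (S n) ^ 2 * (m ^ 2 * q ^ n))%R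
        with (m ^ 2 * (INR (S n) ^ 2 * q ^ n))%R by ring.
      rewrite Rmult_assoc; apply Rmult_le_compat_l; [apply pow2_ge_0|apply H]. }
  assert (Hg := is_series_scaled_geom (m ^ 2 * M) p ltac:(lra)).
  assert (Hex : ex_series (fun n => (m ^ 2 * M * p ^ n)%R)) by (eexists; exact Hg).
  assert (HS : in_S f).
  { exists u; split; [exact Hu|].
    apply (ex_series_le (V := R_CompleteNormedModule) _ _) with (2 := Hex).
    intros n; unfold norm; simpl; unfold abs; simpl.
    rewrite Rabs_pos_eq; apply Hw. }
  split; [exact HS|].
  rewrite Snorm_eq, (coef_eq f u Hu) by assumption.
  rewrite <- (sqrt_pow2 m Hm) at 1; rewrite <- sqrt_mult_alt
    by (apply Rlt_le, Rdiv_lt_0_compat; lra).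
  apply sqrt_le_1_alt; eapply Rle_trans; [apply Series_le; [exact Hw|exact Hex]|].
  rewrite (is_series_unique _ _ Hg); right; field; lra.
Qed.

(** Evaluation of the derivative is bounded, uniformly for [|w| <= q]: coefficients are at most the
    norm, so [Snorm f * (n+1) * q^n] dominates. *)
Lemma cderiv_series (q : R) :
  (0 < q < 1)%R -> exists N, (0 <= N)%R /\
    forall f w, in_S f -> (Cmod w <= q)%R ->
    cseries (fun n => RtoC (INR (S n)) * coef f (S n) * w ^ n) (cderiv f w) /\
    (Cmod (cderiv f w) <= N * Snorm f)%R.
Proof.
  intros Hq; destruct (linear_geom q Hq) as [p [M [Hp [HM H]]]].
  exists (M / (1 - p))%R; split; [apply Rlt_le, Rdiv_lt_0_compat; lra|].
  intros f w Hf Hw.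
  assert (Hb : forall n, (Cmod (RtoC (INR (S n)) * coef f (S n) * w ^ n)
                          <= Snorm f * M * p ^ n)%R).
  { intros n; rewrite !Cmod_mult, Cmod_R, Cmod_pow, Rabs_pos_eq by apply pos_INR.
    assert (H1 := coef_le_Snorm f (S n) Hf); assert (H2 := Cmod_ge_0 (coef f (S n))).
    assert (H3 := pos_INR (S n)).
    assert (H4 : (0 <= Cmod w ^ n <= q ^ n)%R).
    { split; [apply pow_le, Cmod_ge_0|apply pow_incr; split; [apply Cmod_ge_0|exact Hw]]. }
    apply Rle_trans with (INR (S n) * Snorm f * q ^ n)%R.
    - apply Rmult_le_compat; [nra|lra|nra|lra].
    - specialize (H n); nra. }
  destruct (cseries_geom_dominated (Snorm f * M) p _ ltac:(lra) Hb) as [l Hl].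
  assert (E : cderiv f w = l) by (apply csum_eq, Hl).
  rewrite E; split; [exact Hl|].
  eapply Rle_trans; [apply (cseries_geom_le (Snorm f * M) p _ l ltac:(lra) Hb Hl)|].
  right; field; lra.
Qed.

Lemma cderiv_plus (f g : C -> C) (w : C) (q : R) :
  (0 < q < 1)%R -> (Cmod w <= q)%R -> in_S f -> in_S g ->
  cderiv (fun z => f z + g z) w = cderiv f w + cderiv g w.
Proof.
  intros Hq Hw Hf Hg; destruct (cderiv_series q Hq) as [N [_ HN]].
  unfold cderiv at 1; apply csum_eq.
  rewrite (coef_eq _ _ (has_coefs_plus _ _ _ _ (proj1 (in_S_coef f Hf)) (proj1 (in_S_coef g Hg)))).
  eapply cseries_ext; [|apply cseries_plus; [apply (HN f w Hf Hw)|apply (HN g w Hg Hw)]].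
  intros n; simpl; ring.
Qed.

Lemma cderiv_scal (l : C) (f : C -> C) (w : C) (q : R) :
  (0 < q < 1)%R -> (Cmod w <= q)%R -> in_S f ->
  cderiv (fun z => l * f z) w = l * cderiv f w.
Proof.
  intros Hq Hw Hf; destruct (cderiv_series q Hq) as [N [_ HN]].
  unfold cderiv at 1; apply csum_eq.
  rewrite (coef_eq _ _ (has_coefs_scal l _ _ (proj1 (in_S_coef f Hf)))).
  eapply cseries_ext; [|apply cseries_scal, (HN f w Hf Hw)].
  intros n; simpl; ring.
Qed.

(** * Taylor expansion of z f'(phi(z)) *)

Lemma cseries_lmul (p q z l : C) (u : nat -> C) :
  cseries (fun n => u n * z ^ n) l ->
  cseries (fun n => lmul p q u n * z ^ n) ((p * z + q) * l).
Proof.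
  intros H.
  apply cseries_ext with (fun n => q * (u n * z ^ n)
    + match n with O => RtoC 0%R | S m => p * z * (u m * z ^ m) end).
  - intros [|n]; simpl; ring.
  - replace ((p * z + q) * l) with (q * l + (RtoC 0%R + p * z * l)) by ring.
    apply cseries_plus; [now apply cseries_scal|].
    apply (cseries_cons (fun n => match n with O => RtoC 0%R | S m => p * z * (u m * z ^ m) end)).
    now apply cseries_scal.
Qed.

Lemma Cmod_pow_le_1 (z : C) (n : nat) : in_disk z -> (Cmod (z ^ n) <= 1)%R.
Proof.
  intros Hz; rewrite Cmod_pow, <- (pow1 n).
  apply pow_incr; split; [apply Cmod_ge_0|now apply Rlt_le].
Qed.

(** The geometric bound gives convergence to some [l]; then [(c z + d) l = (a z + b) phi^k]
    identifies [l] without multiplying series. *)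
Lemma lft_pow_series (a b c d z : C) (T : R) (k : nat) :
  (1 < T)%R -> d <> RtoC 0%R -> c * z + d <> RtoC 0%R -> in_disk z ->
  (forall z, (Cmod z <= T)%R -> (T * Cmod (a * z + b) <= Cmod (c * z + d))%R) ->
  cseries (fun n => lft_coef a b c d k n * z ^ n) (lft a b c d z ^ k).
Proof.
  intros HT Hd Hden Hz Hb.
  assert (HTi : (0 < / T < 1)%R) by now apply Rinv_unit_interval.
  induction k as [|k IHk].
  - replace (lft a b c d z ^ 0) with (lft_coef a b c d 0 0 * z ^ 0) by (simpl; ring).
    apply (cseries_single (fun n => lft_coef a b c d 0 n * z ^ n)); intros n; simpl; ring.
  - destruct (cseries_geom_dominated ((/ T) ^ S k) (/ T)
                (fun n => lft_coef a b c d (S k) n * z ^ n)) as [l Hl]; [lra| |].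
    { intros n; rewrite Cmod_mult.
      assert (H1 := lft_coef_geom a b c d T (S k) n HT Hd Hb).
      assert (H2 := Cmod_pow_le_1 z n Hz); assert (H3 := Cmod_ge_0 (z ^ n)).
      assert (H4 := Cmod_ge_0 (lft_coef a b c d (S k) n)); nra. }
    replace (lft a b c d z ^ S k) with l; [exact Hl|].
    assert (E : (c * z + d) * l = (a * z + b) * lft a b c d z ^ k).
    { apply cseries_unique with (1 := cseries_lmul c d z l _ Hl).
      rewrite lmul_lft_coef by assumption; now apply cseries_lmul. }
    transitivity ((c * z + d) * l / (c * z + d)); [field; exact Hden|].
    rewrite E; simpl; unfold lft at 2; field; exact Hden.
Qed.

(** By the bound, a zero of the denominator is one of the numerator, which forces
    [a d - b c = 0]. *)
Lemma lft_den_neq_0 (a b c d z : C) (T : R) :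
  a * d - b * c <> RtoC 0%R -> (0 < T)%R ->
  (T * Cmod (a * z + b) <= Cmod (c * z + d))%R -> c * z + d <> RtoC 0%R.
Proof.
  intros Hdet HT H E; apply Hdet.
  rewrite E, Cmod_0 in H.
  assert (E' : a * z + b = RtoC 0%R)
    by (apply Cmod_eq_0; assert (H' := Cmod_ge_0 (a * z + b)); nra).
  replace (a * d - b * c) with (a * (c * z + d) - c * (a * z + b)) by ring.
  rewrite E, E'; ring.
Qed.

(** Each [phi^k] in [f'(phi) = sum (k+1) a_(k+1) phi^k] is expanded in powers of [z] and the sums
    are exchanged. Thus [e n] is the coefficient of [z^n] in [f'(phi)]; the factor [z] shifts it by
    one. *)
Lemma Tz_Dop_coefs (a b c d : C) (T : R) (f : C -> C) :
  (1 < T)%R -> a * d - b * c <> RtoC 0%R ->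
  (forall z, (Cmod z <= T)%R -> (T * Cmod (a * z + b) <= Cmod (c * z + d))%R) ->
  in_S f ->
  exists e : nat -> C,
    (forall n, cseries (fun k => RtoC (INR (S k)) * coef f (S k) * lft_coef a b c d k n) (e n)) /\
    has_coefs (Tz (Dop (lft a b c d) f)) (fun n => match n with O => RtoC 0%R | S m => e m end).
Proof.
  intros HT Hdet Hb Hf.
  assert (HTi : (0 < / T < 1)%R) by now apply Rinv_unit_interval.
  assert (Hden : forall z, in_disk z -> c * z + d <> RtoC 0%R).
  { intros z Hz; apply lft_den_neq_0 with (T := T) (1 := Hdet); [lra|].
    apply Hb; unfold in_disk in Hz; lra. }
  assert (Hd : d <> RtoC 0%R).
  { replace d with (c * RtoC 0%R + d) by ring; apply Hden.
    unfold in_disk; rewrite Cmod_0; lra. }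
  assert (Hg := fun k n => lft_coef_geom a b c d T k n HT Hd Hb).
  set (q := (/ T)%R) in *.
  destruct (linear_geom q HTi) as [p [M [Hp [HM HpM]]]].
  assert (Hqp : forall n, (0 <= q ^ n <= p ^ n)%R)
    by (intros n; split; [apply pow_le; lra|apply pow_incr; lra]).
  assert (HN := Snorm_pos f).
  assert (Ht : forall k n, (Cmod (RtoC (INR (S k)) * coef f (S k) * lft_coef a b c d k n)
                            <= Snorm f * M * p ^ k * p ^ n)%R).
  { intros k n; rewrite !Cmod_mult, Cmod_R, Rabs_pos_eq by apply pos_INR.
    assert (H1 := coef_le_Snorm f (S k) Hf); assert (H2 := Cmod_ge_0 (coef f (S k))).
    assert (H3 := pos_INR (S k)); assert (H4 := Cmod_ge_0 (lft_coef a b c d k n)).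
    apply Rle_trans with (INR (S k) * Snorm f * (q ^ n * q ^ k))%R.
    - apply Rmult_le_compat; [nra|lra|nra|apply Hg].
    - replace (INR (S k) * Snorm f * (q ^ n * q ^ k))%R
        with (Snorm f * (INR (S k) * q ^ k) * q ^ n)%R by ring.
      apply Rmult_le_compat; [|apply Hqp| |apply Hqp].
      + apply Rmult_le_pos; [lra|apply Rmult_le_pos; [lra|apply Hqp]].
      + rewrite Rmult_assoc; apply Rmult_le_compat_l; [lra|apply HpM]. }
  assert (Hex : exists e : nat -> C, forall n,
    cseries (fun k => RtoC (INR (S k)) * coef f (S k) * lft_coef a b c d k n) (e n)).
  { exists (fun n => csum (fun k => RtoC (INR (S k)) * coef f (S k) * lft_coef a b c d k n)).
    intros n.
    destruct (cseries_geom_dominated (Snorm f * M * p ^ n) p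
       (fun k => RtoC (INR (S k)) * coef f (S k) * lft_coef a b c d k n)) as [l Hl]; [lra| |].
    - intros k; eapply Rle_trans; [apply Ht|]; right; ring.
    - now rewrite (csum_eq _ _ Hl). }
  destruct Hex as [e He]; exists e; split; [exact He|].
  intros z Hz.
  assert (Hlft : (Cmod (lft a b c d z) <= q)%R).
  { unfold lft; rewrite Cmod_div by (now apply Hden).
    assert (H1 := Hb z ltac:(unfold in_disk in Hz; lra)).
    assert (H2 := proj1 (Cmod_gt_0 _) (Hden z Hz)).
    apply Rmult_le_reg_r with (Cmod (c * z + d)); [assumption|].
    unfold Rdiv; rewrite Rmult_assoc, Rinv_l, Rmult_1_r by lra.
    apply Rmult_le_reg_l with T; [lra|].
    unfold q; rewrite <- Rmult_assoc, Rinv_r; lra. }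
  destruct (cderiv_series q HTi) as [N [_ HNd]].
  destruct (HNd f (lft a b c d z) Hf Hlft) as [Hder _].
  assert (HF : cseries (fun n => e n * z ^ n) (cderiv f (lft a b c d z))).
  { apply cseries_fubini with (M := (Snorm f * M)%R) (p := p)
      (t := fun k n => RtoC (INR (S k)) * coef f (S k) * lft_coef a b c d k n * z ^ n)
      (r := fun k => RtoC (INR (S k)) * coef f (S k) * lft a b c d z ^ k).
    - lra.
    - intros k n; rewrite Cmod_mult, <- (Rmult_1_r (_ * p ^ n)).
      apply Rmult_le_compat; [apply Cmod_ge_0|apply Cmod_ge_0|apply Ht|].
      now apply Cmod_pow_le_1.
    - intros k; eapply cseries_ext; [|apply cseries_scal,
        (lft_pow_series a b c d z T k HT Hd (Hden z Hz) Hz Hb)].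
      intros n; simpl; ring.
    - intros n; apply cseries_ext with (fun k => z ^ n *
        (RtoC (INR (S k)) * coef f (S k) * lft_coef a b c d k n)); [intros k; ring|].
      replace (e n * z ^ n) with (z ^ n * e n) by ring.
      now apply cseries_scal.
    - exact Hder. }
  unfold Tz, Dop.
  replace (z * cderiv f (lft a b c d z))
    with (RtoC 0%R * z ^ 0 + z * cderiv f (lft a b c d z)) by ring.
  apply (cseries_cons (fun n => (match n with O => RtoC 0%R | S m => e m end) * z ^ n)).
  apply cseries_ext with (fun n => z * (e n * z ^ n)); [intros n; simpl; ring|].
  now apply cseries_scal.
Qed.

(** * The rank-two correction *)

(* [log_kernel beta z = - z log (1 - beta z)]. *)
Definition log_coef (beta : C) (n : nat) : C :=
  match n with S (S m) => beta ^ S m / RtoC (INR (S m)) | _ => RtoC 0%R end.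

Definition log_kernel (beta z : C) : C := csum (fun n => log_coef beta n * z ^ n).

(* On kernel functions, [D_phi^* T_z^* K_w - T_z D_sigma K_w] equals
   [conj w * z * (log (1 - conj w * sigma z) - log (1 - conj (phi w) * z))], and
   the quotient [(1 - conj w * sigma z) / (1 - conj (phi w) * z)] is the product of a
   function of [w] and [1 / (1 - conj (b / d) * z)]. Since [conj w] is the first coefficient
   of [K_w], this is [correction (sigma 0) (conj (b / d)) K_w]. *)
Definition correction (s beta : C) (f : C -> C) (z : C) : C :=
  (coef f 1 - cderiv f s) * z + coef f 1 * log_kernel beta z.

Definition z_coef (n : nat) : C := match n with 1%nat => RtoC 1%R | _ => RtoC 0%R end.

Lemma has_coefs_id : has_coefs (fun z => z) z_coef.
Proof.
  intros z Hz.
  assert (H : cseries (fun n => z_coef n * z ^ n) (z_coef 0 * z ^ 0 + z_coef 1 * z ^ 1)).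
  { apply (cseries_cons (fun n => z_coef n * z ^ n)).
    apply (cseries_single (fun n => z_coef (S n) * z ^ S n)); intros n; simpl; ring. }
  now replace (z_coef 0 * z ^ 0 + z_coef 1 * z ^ 1) with z in H by (simpl; ring).
Qed.

Lemma z_coef_le (q : R) (n : nat) : (0 < q < 1)%R -> (Cmod (z_coef n) <= / q * q ^ n)%R.
Proof.
  intros Hq; assert (Hqi : (0 < / q)%R) by (apply Rinv_0_lt_compat; lra).
  destruct n as [|[|n]]; cbn [z_coef].
  - rewrite Cmod_0; simpl; lra.
  - rewrite Cmod_1, pow_1, Rinv_l; lra.
  - rewrite Cmod_0; apply Rmult_le_pos; [lra|apply pow_le; lra].
Qed.

(** The exponent of [beta] is one less than the index; the factor [1/q] compensates. *)
Lemma log_coef_le (q : R) (beta : C) (n : nat) :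
  (0 < q < 1)%R -> (Cmod beta <= q)%R -> (Cmod (log_coef beta n) <= / q * q ^ n)%R.
Proof.
  intros Hq Hb; assert (Hqi : (0 < / q)%R) by (apply Rinv_0_lt_compat; lra).
  assert (Hpos : forall m, (0 <= / q * q ^ m)%R)
    by (intros m; apply Rmult_le_pos; [lra|apply pow_le; lra]).
  destruct n as [|[|n]]; cbn [log_coef]; [rewrite Cmod_0; apply Hpos| rewrite Cmod_0; apply Hpos|].
  assert (Hn : (1 <= INR (S n))%R) by (rewrite S_INR; assert (H := pos_INR n); lra).
  rewrite Cmod_div, Cmod_R, Rabs_pos_eq, Cmod_pow
    by (lra || (intros E; apply RtoC_inj in E; lra)).
  replace (/ q * q ^ S (S n))%R with (q ^ S n * 1)%R by (simpl; field; lra).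
  apply Rmult_le_compat.
  - apply pow_le, Cmod_ge_0.
  - left; apply Rinv_0_lt_compat; lra.
  - apply pow_incr; split; [apply Cmod_ge_0|exact Hb].
  - rewrite <- Rinv_1; apply Rinv_le_contravar; lra.
Qed.

Lemma has_coefs_log_kernel (beta : C) :
  (Cmod beta < 1)%R -> has_coefs (log_kernel beta) (log_coef beta).
Proof.
  intros Hb z Hz; unfold log_kernel.
  assert (Hb0 := Cmod_ge_0 beta).
  (* The midpoint of [|beta|] and 1 is positive even for [beta = 0]. *)
  set (q := ((1 + Cmod beta) / 2)%R).
  destruct (cseries_geom_dominated (/ q) q (fun n => log_coef beta n * z ^ n)) as [l Hl].
  - unfold q; lra.
  - intros n; rewrite Cmod_mult.
    assert (H1 := log_coef_le q beta n ltac:(unfold q; lra) ltac:(unfold q; lra)).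
    assert (H2 := Cmod_pow_le_1 z n Hz); assert (H3 := Cmod_ge_0 (z ^ n)).
    assert (H4 := Cmod_ge_0 (log_coef beta n)); nra.
  - now rewrite (csum_eq _ _ Hl).
Qed.

Lemma has_coefs_correction (s beta : C) (f : C -> C) :
  (Cmod beta < 1)%R ->
  has_coefs (correction s beta f)
    (fun n => (coef f 1 - cderiv f s) * z_coef n + coef f 1 * log_coef beta n).
Proof.
  intros Hb; apply has_coefs_plus; apply has_coefs_scal;
    [apply has_coefs_id|now apply has_coefs_log_kernel].
Qed.

(** The range lies in the span of [z] and the logarithm, whose coefficients decay geometrically; the
    scalars are bounded functionals because [s] lies inside the disk. *)
Lemma finite_rank_correction (s beta : C) :
  (Cmod s < 1)%R -> (Cmod beta < 1)%R -> finite_rank_op (correction s beta).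
Proof.
  intros Hs Hb; assert (Hs0 := Cmod_ge_0 s); assert (Hb0 := Cmod_ge_0 beta).
  set (q := ((1 + Rmax (Cmod s) (Cmod beta)) / 2)%R).
  assert (Hq : (0 < q < 1)%R /\ (Cmod s <= q)%R /\ (Cmod beta <= q)%R).
  { assert (H1 := Rmax_l (Cmod s) (Cmod beta)); assert (H2 := Rmax_r (Cmod s) (Cmod beta)).
    assert (H3 := Rmax_lub_lt _ _ 1 Hs Hb); unfold q; lra. }
  clearbody q; destruct Hq as [Hq [Hsq Hbq]].
  assert (Hqi : (0 < / q)%R) by (apply Rinv_0_lt_compat; lra).
  destruct (in_S_geom q Hq) as [N [HN HNS]].
  destruct (cderiv_series q Hq) as [N' [HN' Hder]].
  assert (bound : forall f, in_S f -> in_S (correction s beta f) /\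
            (Snorm (correction s beta f) <= N * ((2 + N') * / q) * Snorm f)%R).
  { intros f Hf; assert (Hn := Snorm_pos f).
    replace (N * ((2 + N') * / q) * Snorm f)%R with (N * ((2 + N') * Snorm f * / q))%R by ring.
    apply HNS with (2 := has_coefs_correction s beta f Hb).
    - apply Rmult_le_pos; [apply Rmult_le_pos|]; lra.
    - intros n; eapply Rle_trans; [apply Cmod_triangle|]; rewrite !Cmod_mult.
      assert (H1 := z_coef_le q n Hq); assert (H2 := log_coef_le q beta n Hq Hbq).
      assert (H3 := coef_le_Snorm f 1 Hf).
      assert (H4 : (Cmod (coef f 1 - cderiv f s) <= (1 + N') * Snorm f)%R).
      { unfold Cminus; eapply Rle_trans; [apply Cmod_triangle|]; rewrite Cmod_opp.
        assert (H4 := proj2 (Hder f s Hf Hsq)); lra. }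
      apply Rle_trans with ((1 + N') * Snorm f * (/ q * q ^ n) + Snorm f * (/ q * q ^ n))%R;
        [|right; ring].
      apply Rplus_le_compat; apply Rmult_le_compat; auto using Cmod_ge_0. }
  repeat split.
  - intros f Hf; now apply bound.
  - intros f g Hf Hg z Hz; unfold correction.
    rewrite (cderiv_plus f g s q) by assumption.
    rewrite (coef_eq _ _ (has_coefs_plus _ _ _ _ (proj1 (in_S_coef f Hf)) (proj1 (in_S_coef g Hg)))).
    ring.
  - intros l f Hf z Hz; unfold correction.
    rewrite (cderiv_scal l f s q) by assumption.
    rewrite (coef_eq _ _ (has_coefs_scal l _ _ (proj1 (in_S_coef f Hf)))).
    ring.
  - exists (N * ((2 + N') * / q))%R; intros f Hf; now apply bound.
  - exists 2%nat, (fun i => match i with O => fun z => z | _ => log_kernel beta end); split.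
    + intros [|i] _.
      * apply (HNS _ z_coef (/ q)%R); [lra|apply has_coefs_id|].
        intros n; now apply z_coef_le.
      * apply (HNS _ (log_coef beta) (/ q)%R); [lra|now apply has_coefs_log_kernel|].
        intros n; now apply log_coef_le.
    + intros f Hf.
      exists (fun i => match i with O => coef f 1 - cderiv f s | _ => coef f 1 end).
      intros z Hz; unfold correction; simpl; ring.
Qed.

(** Row [n] of the double series, before the factor from [g]. Entries with [n, k >= 1] are matched
    by the duality of coefficients; the row [n = 0] and the column [k = 0] produce the
    correction. *)
Lemma adjoint_row (a b c d : C) (f : C -> C) (e : nat -> C) (n : nat) :
  d <> RtoC 0%R ->
  (forall n, cseries (fun k => RtoC (INR (S k)) * coef f (S k)
     * lft_coef (Cconj a) (- Cconj c) (- Cconj b) (Cconj d) k n) (e n)) ->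
  cseries (fun k => RtoC (weight (S k)) * RtoC (INR (S n)) * Cconj (lft_coef a b c d n k)
                    * coef f (S k))
    (RtoC (weight (S n)) *
       (e n + ((coef f 1 - e O) * z_coef (S n)
               + coef f 1 * log_coef (Cconj (b / d)) (S n)))).
Proof.
  intros Hd He.
  assert (Hd' : Cconj d <> RtoC 0%R).
  { intros E; apply Hd; rewrite <- (Cconj_conj d), E; apply Cconj_RtoC. }
  destruct n as [|n].
  (* Row 0 has only its entry [k = 0], since [phi^0 = 1]; there the multiple of [z] in the
     correction replaces [e O] by [coef f 1]. *)
  - match goal with |- is_series ?u ?l => replace l with (u O) end.
    + apply (cseries_single (fun k => RtoC (weight (S k)) * RtoC (INR 1)
        * Cconj (lft_coef a b c d 0 k) * coef f (S k))).
      intros k; cbn [lft_coef]; rewrite Cconj_RtoC; ring.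
    + cbn [weight lft_coef z_coef log_coef]; rewrite Cconj_RtoC; simpl INR; ring.
  - set (u := fun k => _).
    assert (Hnz : RtoC (INR (S n)) <> RtoC 0%R).
    { intros E; apply RtoC_inj in E; now apply (not_0_INR (S n)). }
    (* The entry [k = 0] carries the conjugate of [phi(0)^(n+1)], with [phi(0) = b / d]; dividing by
       the weight gives the logarithmic coefficient. *)
    assert (E0 : u O = RtoC (weight (S (S n))) * (coef f 1 * log_coef (Cconj (b / d)) (S (S n)))).
    { unfold u; rewrite lft_coef_0_r, Cpow_conj, weight_SS; cbn [weight log_coef].
      rewrite RtoC_mult; field; exact Hnz. }
    replace (RtoC (weight (S (S n))) * _) with (u O + RtoC (weight (S (S n))) * (e (S n) - RtoC 0%R))
      by (rewrite E0; cbn [z_coef]; ring).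
    apply (cseries_cons u).
    (* Nothing is lost by dropping [k = 0] here: [sigma^0 = 1] has no coefficient at [z^(n+1)]. *)
    assert (Ht := cseries_tail _ _ (He (S n))); cbn [lft_coef] in Ht.
    rewrite Cmult_0_r in Ht.
    eapply cseries_ext; [|apply cseries_scal, Ht].
    intros k; unfold u; cbv beta.
    assert (Hadj := lft_coef_adjoint (Cconj a) (Cconj b) (Cconj c) (Cconj d) k n Hd').
    rewrite <- lft_coef_conj in Hadj by assumption.
    cbn [lft_coef] in Hadj |- *.
    rewrite !weight_SS, !RtoC_mult.
    transitivity (RtoC (INR (S (S n))) * RtoC (INR (S (S k))) * coef f (S (S k)) *
      (RtoC (INR (S n)) * lmul (Cconj a) (- Cconj c) (ldiv (- Cconj b) (Cconj d)
        (lft_coef (Cconj a) (- Cconj c) (- Cconj b) (Cconj d) k)) (S n))); [ring|].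
    rewrite Hadj; ring.
Qed.

(** As [D_phi^* T_z^*] is the adjoint of [T_z D_phi], the operator identity is expressed by pairing
    with all [f] and [g]. *)
Theorem theorem6p5 (a b c d : C) :
  a * d - b * c <> RtoC 0%R ->
  (forall z, in_disk z -> c * z + d <> RtoC 0%R) ->
  (exists r : R, (r < 1)%R /\ forall z, in_disk z -> (Cmod (lft a b c d z) <= r)%R) ->
  exists K1 : (C -> C) -> (C -> C),
    finite_rank_op K1 /\
    forall f g, in_S f -> in_S g ->
      ip (fun z => Tz (Dop (krein_adjoint a b c d) f) z + K1 f z) g
      = ip f (Tz (Dop (lft a b c d) g)).
Proof.
  intros Hdet Hden [r [Hr Hphi]].
  destruct (lft_extend a b c d r Hdet Hden Hr Hphi) as [T [HT Hext]].
  assert (Hsig := krein_adjoint_bound a b c d T Hext).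
  assert (H0 : in_disk (RtoC 0%R)) by (unfold in_disk; rewrite Cmod_0; lra).
  assert (Hphib : forall z, (Cmod z <= T)%R -> (T * Cmod (a * z + b) <= Cmod (c * z + d))%R)
    by (intros; now apply Rlt_le, Hext).
  assert (Hdet' : Cconj a * Cconj d - - Cconj c * - Cconj b <> RtoC 0%R).
  { intros E; apply Hdet; rewrite <- (Cconj_conj (a * d - b * c)).
    rewrite Cminus_conj, !Cmult_conj.
    replace (Cconj a * Cconj d - Cconj b * Cconj c)
      with (Cconj a * Cconj d - - Cconj c * - Cconj b) by ring.
    rewrite E; apply Cconj_RtoC. }
  assert (Hd : d <> RtoC 0%R).
  { replace d with (c * RtoC 0%R + d) by ring; now apply Hden. }
  assert (Hd' : Cconj d <> RtoC 0%R).
  { replace (Cconj d) with (- Cconj b * RtoC 0%R + Cconj d) by ring.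
    apply lft_den_neq_0 with (1 := Hdet') (T := T); [lra|].
    apply Hsig; rewrite Cmod_0; lra. }
  set (q := (/ T)%R).
  assert (Hq : (0 < q < 1)%R) by now apply Rinv_unit_interval.
  assert (ratio : forall x y : C, y <> RtoC 0%R -> (T * Cmod x <= Cmod y)%R ->
                  (Cmod (x / y) <= q)%R).
  { intros x y Hy Hxy; rewrite Cmod_div by assumption.
    assert (Hy' := proj1 (Cmod_gt_0 _) Hy).
    apply Rmult_le_reg_r with (Cmod y); [assumption|].
    unfold Rdiv; rewrite Rmult_assoc, Rinv_l, Rmult_1_r by lra.
    apply Rmult_le_reg_l with T; [lra|].
    unfold q; rewrite <- Rmult_assoc, Rinv_r; lra. }
  (* This is [sigma(0)], so [cderiv f s] is the constant coefficient of [f'(sigma)]. *)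
  set (s := - Cconj c / Cconj d).
  assert (Hs : (Cmod s <= q)%R).
  { apply ratio; [assumption|].
    assert (H := Hsig (RtoC 0%R)); rewrite Cmod_0, !Cmult_0_r, !Cplus_0_l in H; apply H; lra. }
  assert (Hbeta : (Cmod (Cconj (b / d)) <= q)%R).
  { rewrite Cmod_conj; apply ratio; [assumption|].
    assert (H := Hphib (RtoC 0%R)); rewrite Cmod_0, !Cmult_0_r, !Cplus_0_l in H; apply H; lra. }
  exists (correction s (Cconj (b / d))); split.
  { apply finite_rank_correction; lra. }
  intros f g Hf Hg.
  destruct (Tz_Dop_coefs (Cconj a) (- Cconj c) (- Cconj b) (Cconj d) T f HT Hdet' Hsig Hf)
    as [e [He HF]].
  destruct (Tz_Dop_coefs a b c d T g HT Hdet Hphib Hg) as [h [Hh HG]].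
  assert (HFc := has_coefs_plus _ _ _ _ HF
    (has_coefs_correction s (Cconj (b / d)) f ltac:(lra))).
  assert (Es : cderiv f s = e O).
  { apply csum_eq; eapply cseries_ext; [|exact (He O)].
    intros k; simpl; now rewrite lft_coef_0_r. }
  unfold ip.
  change (krein_adjoint a b c d) with (lft (Cconj a) (- Cconj c) (- Cconj b) (Cconj d)).
  rewrite (coef_eq _ _ HFc), (coef_eq _ _ HG), Es.
  set (u := fun n : nat => match n with O => RtoC 0%R | S m => e m end
    + ((coef f 1 - e O) * z_coef n + coef f 1 * log_coef (Cconj (b / d)) n)).
  assert (Hrow := fun n => adjoint_row a b c d f e n Hd He).
  (* The common double series, with [n] belonging to [g] and [k] to [f]; indices start at 1 because
     all images vanish at 0. *)
  set (t := fun n k : nat => RtoC (weight (S k)) * RtoC (INR (S n))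
      * Cconj (lft_coef a b c d n k) * coef f (S k) * Cconj (coef g (S n))).
  (* The weight is at most [(k+1)^2]; enlarging [n + 1] to [(n+1)^2] lets the same [p] and [M] serve
     both indices. *)
  destruct (quadratic_geom q Hq) as [p [M [Hp [HM HpM]]]].
  assert (Ht : forall n k, (Cmod (t n k) <= Snorm f * Snorm g * M ^ 2 * p ^ n * p ^ k)%R).
  { intros n k; unfold t.
    assert (H1 := coef_le_Snorm f (S k) Hf); assert (H2 := coef_le_Snorm g (S n) Hg).
    assert (H3 := lft_coef_geom a b c d T n k HT Hd Hphib); fold q in H3.
    assert (H4 := weight_ge_1 (S k)); assert (H5 := weight_le k).
    assert (H6 : (1 <= INR (S n))%R) by (rewrite S_INR; assert (H := pos_INR n); lra).
    rewrite !Cmod_mult, !Cmod_conj, !Cmod_R, !Rabs_pos_eq by lra.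
    apply Rle_trans with
      (INR (S k) ^ 2 * INR (S n) ^ 2 * (q ^ k * q ^ n) * Snorm f * Snorm g)%R.
    - repeat (apply Rmult_le_compat; [repeat apply Rmult_le_pos; try apply Cmod_ge_0; lra
        | try apply Cmod_ge_0; lra| |]); try assumption; nra.
    - replace (INR (S k) ^ 2 * INR (S n) ^ 2 * (q ^ k * q ^ n) * Snorm f * Snorm g)%R
        with (Snorm f * Snorm g * ((INR (S n) ^ 2 * q ^ n) * (INR (S k) ^ 2 * q ^ k)))%R by ring.
      replace (Snorm f * Snorm g * M ^ 2 * p ^ n * p ^ k)%R
        with (Snorm f * Snorm g * ((M * p ^ n) * (M * p ^ k)))%R by ring.
      assert (Hpos : forall m, (0 <= INR (S m) ^ 2 * q ^ m)%R).
      { intros m; apply Rmult_le_pos; [apply pow2_ge_0|apply pow_le; lra]. }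
      apply Rmult_le_compat_l; [apply Rmult_le_pos; apply Snorm_pos|].
      apply Rmult_le_compat; auto. }
  (* Row sums are the terms of the left inner product. *)
  assert (Hr1 : forall n, cseries (t n)
      (RtoC (weight (S n)) * u (S n) * Cconj (coef g (S n)))).
  { intros n; eapply cseries_ext; [|replace (RtoC (weight (S n)) * u (S n) * Cconj (coef g (S n)))
      with (Cconj (coef g (S n)) * (RtoC (weight (S n)) * u (S n))) by ring;
      apply cseries_scal, (Hrow n)].
    intros k; unfold t; ring. }
  (* Column sums are the terms of the right inner product. *)
  assert (Hc1 : forall k, cseries (fun n => t n k)
      (RtoC (weight (S k)) * coef f (S k) * Cconj (h k))).
  { intros k; eapply cseries_ext; [|apply cseries_scal, cseries_conj, (Hh k)].
    intros n; unfold t; rewrite !Cmult_conj.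
    rewrite Cconj_RtoC; ring. }
  destruct (cseries_geom_dominated (Snorm f * Snorm g * M ^ 2 / (1 - p)) p
    (fun n => RtoC (weight (S n)) * u (S n) * Cconj (coef g (S n)))) as [l Hl]; [lra| |].
  { intros n; replace (Snorm f * Snorm g * M ^ 2 / (1 - p) * p ^ n)%R
      with (Snorm f * Snorm g * M ^ 2 * p ^ n / (1 - p))%R by (field; lra).
    apply cseries_geom_le with (3 := Hr1 n); [lra|apply Ht]. }
  assert (Hl' := cseries_fubini _ p t _ _ l ltac:(lra) Ht Hr1 Hc1 Hl).
  transitivity l; [|symmetry]; apply csum_eq.
  - assert (H := cseries_cons (fun n => RtoC (weight n) * u n * Cconj (coef g n)) l Hl).
    cbv beta in H; replace (RtoC (weight 0) * u O * Cconj (coef g O) + l) with l in H; [exact H|].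
    unfold u; cbn [z_coef log_coef]; ring.
  - set (v := fun n => RtoC (weight n) * coef f n
      * Cconj (match n with O => RtoC 0%R | S m => h m end)).
    assert (H := cseries_cons v l Hl').
    replace (v O + l) with l in H; [exact H|].
    unfold v; rewrite Cconj_RtoC; ring.
Qed.
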